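(* Let $\lambda>0$ and $H\ge 0$ be real numbers with $\lambda>2H$. Let $f$ be a function analytic in the whole complex plane satisfying $|f(z)|=O\left(e^{H|z-1|^2}\right)$ as $|z|\to\infty$, and let $A_n$ $(n\ge 0)$ be the Taylor coefficients at $0$ of $F(z)=e^{\lambda(z-1)}f(z)$, i.e. $F(z)=\sum_{n\ge0}A_nz^n$. Then $$\sum_{n\ge0}\left|\frac{A_n}{e^{-\lambda}\frac{\lambda^n}{n!}}\right|^2e^{-\lambda}\frac{\lambda^n}{n!}=\int_0^\infty I\left(\sqrt{r/\lambda}\right)e^{-r}\,dr,$$ where $$I(r):=\frac1{2\pi}\int_{-\pi}^{\pi}\left|f(1+re^{it})\right|^2dt .$$ *)

(* Defs.v *)
(* Classical reals of Stdlib, with Coquelicot for complex numbers, series and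
   integrals. *)
From Stdlib Require Import Reals Factorial.
From Coquelicot Require Import Coquelicot.

Open Scope R_scope.

Definition Cexp (z : C) : C :=
  (exp (Re z) * cos (Im z), exp (Re z) * sin (Im z)).

(* [a] is the sequence of Taylor coefficients of [f] at [z0]: the (unique)
   coefficients of a power series that sums to [f] in some disc around [z0]. *)
Definition taylor_coeffs (f : C -> C) (z0 : C) (a : nat -> C) : Prop :=
  exists r : R, 0 < r /\
    forall w : C, Cmod w < r ->
      is_pseries (K := C_AbsRing) (V := C_NormedModule) a w (f (z0 + w)%C).

Definition analytic_at (f : C -> C) (z0 : C) : Prop :=
  exists a : nat -> C, taylor_coeffs f z0 a.

Definition entire (f : C -> C) : Prop := forall z : C, analytic_at f z.

(* u(z) = O(v(z)) as |z| -> oo, for a nonnegative real bound v. *)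
Definition big_O_at_infinity (u : C -> C) (v : C -> R) : Prop :=
  exists K M : R, forall z : C, M <= Cmod z -> Cmod (u z) <= K * v z.

Definition poisson_weight (lambda : R) (n : nat) : R :=
  exp (- lambda) * (lambda ^ n / INR (fact n)).

(* Mean value of |f|^2 on the circle of centre 1 and radius r. *)
Definition circle_mean (f : C -> C) (r : R) : R :=
  1 / (2 * PI) *
  RInt (fun t => Cmod (f (1 + RtoC r * Cexp (Ci * RtoC t))%C) ^ 2) (- PI) PI.

(* Main.v *)
Require Import Defs.
From Stdlib Require Import Reals Factorial Lra Lia ClassicalEpsilon.
From Coquelicot Require Import Coquelicot.

Open Scope R_scope.

(** Write [f (1 + w) = sum c_k w^k]; local analyticity at every point gives this
    expansion on the whole plane through Cauchy's formula.  By Parseval on circles,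
    [I (sqrt (r / lambda)) = sum |c_k|^2 (r / lambda)^k], so the right-hand side is
    [sigma = sum |c_k|^2 k! / lambda^k], and the growth hypothesis makes it finite.
    On the other side [e^(lambda (z - 1)) (z - 1)^k = sum_n w_n C_k(n) z^n], where
    [w_n] is the Poisson weight and [C_k] a Charlier polynomial; the [C_k] are
    orthogonal in [l^2(w)] with squared norm [k! / lambda^k].  Hence the partial sums
    [sum_(k <= N) c_k C_k] are Cauchy in [l^2(w)], they tend pointwise to
    [A_n / w_n], and the squared norm of the limit is [sigma]. *)

(** * Complex power series *)

(** Analyticity is given as a local power series at each point, whereas the argument needs one
    expansion at [1] that is valid everywhere. Cauchy's formula is therefore proved by shrinking the
    circle onto the point [w] and differentiating under the integral sign. This requires a
    continuous derivative, and strict differentiability supplies it cheaply: it follows from the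
    local series at the point itself, and it forces the derivative to be continuous without
    re-expanding the series at nearby points.

    The exchanges of limits rest on explicit bounds. On the integral side all terms are nonnegative,
    so partial sums and truncated integrals bound each other from both sides. On the discrete side a
    finite section of the sum is passed to the limit first, and its length afterwards. The pointwise
    limit [A_n / w_n] comes from Cauchy's estimate on a circle around [0], applied to [F] minus the
    partial sum.

    The hypothesis [2 * H < lambda] makes [sigma] finite: the circle mean at radius
    [sqrt (r / lambda)] grows at most like [exp (2 * H / lambda * r)], which the factor [exp (- r)]
    beats. *)

Definition psum (a : nat -> C) (w : C) (N : nat) : C :=
  sum_n (fun k => (a k * w ^ k)%C) N.

(** Convergence is encoded by real distances, so that everything below runs on limits of real
    sequences; [psums_is_pseries] is the bridge to the series of the statement. *)
Definition psums (a : nat -> C) (w l : C) : Prop :=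
  is_lim_seq (fun N => Cmod (l - psum a w N)) 0.

Lemma pow_n_Cpow (w : C) (n : nat) : @pow_n C_Ring w n = (w ^ n)%C.
Proof. induction n as [|n IH]; simpl; [|rewrite IH]; reflexivity. Qed.

Lemma C_lim_Cmod (u : nat -> C) (l : C) :
  filterlim u eventually (locally (l : C_NormedModule)) <->
  is_lim_seq (fun n => Cmod (l - u n)) 0.
Proof.
  split; intros Hu.
  - apply is_lim_seq_spec. intros eps.
    assert (Hl : locally (l : C_NormedModule)
                   (fun y => ball_norm (K := C_AbsRing) (V := C_NormedModule) l eps y))
      by (apply locally_le_locally_norm; exists eps; auto).
    generalize (Hu _ Hl). unfold filtermap. intros [N HN].
    exists N. intros n Hn. generalize (HN n Hn). unfold ball_norm.
    change (norm (minus (u n) l)) with (Cmod (u n - l)).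
    intros Hb. rewrite Rminus_0_r, Rabs_pos_eq by apply Cmod_ge_0.
    rewrite <- Cmod_opp. replace (- (l - u n))%C with (u n - l)%C by ring. exact Hb.
  - apply filterlim_locally_ball_norm. intros eps.
    apply is_lim_seq_spec in Hu. destruct (Hu eps) as [N HN].
    exists N. intros n Hn. unfold ball_norm.
    change (norm (minus (u n) l)) with (Cmod (u n - l)).
    generalize (HN n Hn). rewrite Rminus_0_r, Rabs_pos_eq by apply Cmod_ge_0.
    rewrite <- Cmod_opp. replace (- (l - u n))%C with (u n - l)%C by ring. auto.
Qed.

Lemma psums_is_pseries (a : nat -> C) (w l : C) :
  is_pseries (K := C_AbsRing) (V := C_NormedModule) a w l <-> psums a w l.
Proof.
  unfold is_pseries, is_series, psums. rewrite C_lim_Cmod.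
  assert (E : forall n, sum_n (fun k => scal (pow_n w k) (a k)) n = psum a w n).
  { intros n. apply sum_n_ext. intros k.
    change (pow_n w k * a k = a k * w ^ k)%C. rewrite pow_n_Cpow. ring. }
  split; apply is_lim_seq_ext; intros n; now rewrite E.
Qed.

Lemma psum_O (a : nat -> C) (w : C) : psum a w 0 = a 0%nat.
Proof. unfold psum. rewrite sum_O. simpl. ring. Qed.

Lemma psum_S (a : nat -> C) (w : C) (N : nat) :
  psum a w (S N) = (psum a w N + a (S N) * w ^ S N)%C.
Proof. unfold psum. rewrite sum_Sn. reflexivity. Qed.

Lemma psum_plus (a b : nat -> C) (w : C) (N : nat) :
  psum (fun k => a k + b k)%C w N = (psum a w N + psum b w N)%C.
Proof. induction N as [|N IH]; [rewrite !psum_O|rewrite !psum_S, IH]; ring. Qed.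

Lemma psum_scal (c : C) (a : nat -> C) (w : C) (N : nat) :
  psum (fun k => c * a k)%C w N = (c * psum a w N)%C.
Proof. induction N as [|N IH]; [rewrite !psum_O|rewrite !psum_S, IH]; ring. Qed.

Lemma is_lim_seq_0_le (u v : nat -> R) :
  (forall n, 0 <= u n <= v n) -> is_lim_seq v 0 -> is_lim_seq u 0.
Proof.
  intros Huv Hv. apply is_lim_seq_le_le with (fun _ => 0) v; auto.
  apply is_lim_seq_const.
Qed.

Lemma psums_plus (a b : nat -> C) (w l m : C) :
  psums a w l -> psums b w m -> psums (fun k => a k + b k)%C w (l + m)%C.
Proof.
  unfold psums. intros Ha Hb.
  apply is_lim_seq_0_le with
    (fun N => Cmod (l - psum a w N) + Cmod (m - psum b w N)).
  - intros N. split; [apply Cmod_ge_0|]. rewrite psum_plus.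
    replace (l + m - (psum a w N + psum b w N))%C
      with ((l - psum a w N) + (m - psum b w N))%C by ring.
    apply Cmod_triangle.
  - replace (Finite 0) with (Finite (0 + 0)) by (f_equal; ring).
    now apply is_lim_seq_plus'.
Qed.

Lemma psums_scal (c : C) (a : nat -> C) (w l : C) :
  psums a w l -> psums (fun k => c * a k)%C w (c * l)%C.
Proof.
  unfold psums. intros Ha.
  apply is_lim_seq_ext with (fun N => Cmod c * Cmod (l - psum a w N)).
  - intros N. rewrite psum_scal, <- Cmod_mult. f_equal. ring.
  - replace (Finite 0) with (Rbar_mult (Cmod c) 0) by (simpl; f_equal; ring).
    now apply is_lim_seq_scal_l.
Qed.

Lemma psums_ext (a b : nat -> C) (w l m : C) :
  (forall k, a k = b k) -> l = m -> psums a w l -> psums b w m.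
Proof.
  intros Hab <-. unfold psums. apply is_lim_seq_ext. intros N.
  replace (psum b w N) with (psum a w N); auto.
  apply sum_n_ext. intros k. now rewrite Hab.
Qed.

Lemma psums_minus (a b : nat -> C) (w l m : C) :
  psums a w l -> psums b w m -> psums (fun k => a k - b k)%C w (l - m)%C.
Proof.
  intros Ha Hb.
  apply psums_ext with (fun k => a k + (-(1)) * b k)%C (l + (-(1)) * m)%C;
    try intros; try ring.
  apply psums_plus, psums_scal; auto.
Qed.

Lemma psums_sum (a : nat -> nat -> C) (w : C) (l : nat -> C) (N : nat) :
  (forall k, psums (a k) w (l k)) ->
  psums (fun n => sum_n (fun k => a k n) N) w (sum_n l N).
Proof.
  intros Ha. induction N as [|N IH].
  - apply psums_ext with (a 0%nat) (l 0%nat); auto; intros; now rewrite sum_O.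
  - apply psums_ext with (fun n => sum_n (fun k => a k n) N + a (S N) n)%C
      (sum_n l N + l (S N))%C; try (intros; now rewrite sum_Sn).
    now apply psums_plus.
Qed.

Definition shift (a : nat -> C) (n : nat) : C :=
  match n with 0%nat => 0%C | S m => a m end.

Lemma psums_shift (a : nat -> C) (w l : C) :
  psums a w l -> psums (shift a) w (w * l)%C.
Proof.
  intros Ha. apply is_lim_seq_incr_1.
  apply is_lim_seq_ext with (fun N => Cmod w * Cmod (l - psum a w N)).
  - intros N. rewrite <- Cmod_mult. f_equal.
    enough (psum (shift a) w (S N) = w * psum a w N)%C as -> by ring.
    induction N as [|N IH].
    + rewrite psum_S, !psum_O. simpl. ring.
    + rewrite psum_S, IH, psum_S. simpl. ring.
  - replace (Finite 0) with (Rbar_mult (Cmod w) 0) by (simpl; f_equal; ring).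
    now apply is_lim_seq_scal_l.
Qed.

Lemma psums_unique (a : nat -> C) (w l m : C) :
  psums a w l -> psums a w m -> l = m.
Proof.
  intros Hl Hm.
  assert (H : psums (fun k => a k - a k)%C w (l - m)%C) by now apply psums_minus.
  assert (Hz : forall N, psum (fun k => a k - a k)%C w N = 0%C).
  { induction N as [|N IH]; [rewrite psum_O|rewrite psum_S, IH]; ring. }
  assert (H0 : Cmod (l - m) = 0).
  { assert (He : is_lim_seq (fun _ : nat => Cmod (l - m)) 0).
    { revert H. apply is_lim_seq_ext. intros N. rewrite Hz. f_equal. ring. }
    apply is_lim_seq_unique in He. rewrite Lim_seq_const in He. now injection He. }
  apply Cmod_eq_0 in H0. replace l with ((l - m) + m)%C by ring. rewrite H0. ring.
Qed.

(** Explicit domination on the closed disc of radius [rho]: with [M] and [q] fixed, the tail bounds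
    are uniform in the point of the disc. *)
Definition geometric (a : nat -> C) (rho : R) (M q : R) : Prop :=
  0 <= M /\ 0 <= q < 1 /\ forall k, Cmod (a k) * rho ^ k <= M * q ^ k.

Lemma psum_diff_le (a : nat -> C) (rho M q : R) (w : C) (N n : nat) :
  geometric a rho M q -> Cmod w <= rho ->
  Cmod (psum a w (N + n) - psum a w N) <= M * q ^ S N / (1 - q).
Proof.
  intros (HM & Hq & Ha) Hw.
  (* The induction carries the exact sum of the geometric block from [N + 1] to [N + n]; its
     negative part is dropped only at the end. *)
  assert (H : Cmod (psum a w (N + n) - psum a w N)
              <= M * (q ^ S N - q ^ S (N + n)) / (1 - q)).
  { induction n as [|n IH].
    - rewrite Nat.add_0_r.
      replace (psum a w N - psum a w N)%C with (RtoC 0) by ring. rewrite Cmod_0.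
      right; unfold Rdiv; ring.
    - rewrite Nat.add_succ_r, psum_S.
      replace (psum a w (N + n) + a (S (N + n)) * w ^ S (N + n) - psum a w N)%C
        with ((psum a w (N + n) - psum a w N) + a (S (N + n)) * w ^ S (N + n))%C
        by ring.
      eapply Rle_trans; [apply Cmod_triangle|].
      assert (Ht : Cmod (a (S (N + n)) * w ^ S (N + n)) <= M * q ^ S (N + n)).
      { rewrite Cmod_mult, Cmod_pow. eapply Rle_trans; [|apply Ha].
        apply Rmult_le_compat_l; [apply Cmod_ge_0|].
        apply pow_incr; split; [apply Cmod_ge_0|auto]. }
      replace (M * (q ^ S N - q ^ S (S (N + n))) / (1 - q)) with
        (M * (q ^ S N - q ^ S (N + n)) / (1 - q) + M * q ^ S (N + n)).
      + lra.
      + simpl. field. lra. }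
  eapply Rle_trans; [exact H|].
  apply Rmult_le_compat_r; [left; apply Rinv_0_lt_compat; lra|].
  apply Rmult_le_compat_l; auto.
  assert (0 <= q ^ S (N + n)) by (apply pow_le; lra). lra.
Qed.

Lemma psums_tail (a : nat -> C) (rho M q : R) (w l : C) (N : nat) :
  geometric a rho M q -> Cmod w <= rho -> psums a w l ->
  Cmod (l - psum a w N) <= M * q ^ S N / (1 - q).
Proof.
  intros Ha Hw Hl.
  set (B := M * q ^ S N / (1 - q)).
  apply (is_lim_seq_le (fun _ : nat => Cmod (l - psum a w N))
           (fun n => Cmod (l - psum a w (N + n)) + B)
           (Cmod (l - psum a w N)) B).
  - intros n.
    replace (l - psum a w N)%C
      with ((l - psum a w (N + n)) + (psum a w (N + n) - psum a w N))%C by ring.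
    eapply Rle_trans; [apply Cmod_triangle|].
    apply Rplus_le_compat_l. now apply (psum_diff_le a rho).
  - apply is_lim_seq_const.
  - replace (Finite B) with (Finite (0 + B)) by (f_equal; ring).
    apply is_lim_seq_plus'; [|apply is_lim_seq_const].
    apply (is_lim_seq_incr_n _ N) in Hl. revert Hl.
    apply is_lim_seq_ext. intros n. now rewrite Nat.add_comm.
Qed.

Lemma is_lim_seq_geom_tail (M q : R) :
  0 <= q < 1 -> is_lim_seq (fun N => M * q ^ S N / (1 - q)) 0.
Proof.
  intros Hq.
  apply is_lim_seq_ext with (fun N => (M / (1 - q)) * q ^ S N).
  { intros n. field. lra. }
  replace (Finite 0) with (Rbar_mult (M / (1 - q)) 0) by (simpl; f_equal; ring).
  apply is_lim_seq_scal_l, (is_lim_seq_incr_1 (fun n => q ^ n)), is_lim_seq_geom.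
  rewrite Rabs_pos_eq; lra.
Qed.

(** Each term after the first is a difference of two consecutive errors, and the errors are bounded
    because they converge. The summand [Cmod (a 0%nat)] in the witness covers the term of index
    [0]. *)
Lemma psums_terms_bounded (a : nat -> C) (w l : C) :
  psums a w l -> exists M, 0 <= M /\ forall k, Cmod (a k) * Cmod w ^ k <= M.
Proof.
  intros Hl.
  assert (Hb : exists B, forall N, Cmod (l - psum a w N) <= B).
  { destruct (maj_by_pos (fun N => Cmod (l - psum a w N))) as (B & HB & HBn).
    { exists 0. apply is_lim_seq_Reals. exact Hl. }
    exists B. intros N. specialize (HBn N).
    now rewrite Rabs_pos_eq in HBn by apply Cmod_ge_0. }
  destruct Hb as [B HB].
  exists (2 * B + Cmod (a 0%nat)).
  assert (HB0 : 0 <= B) by (eapply Rle_trans; [apply Cmod_ge_0|apply (HB 0%nat)]).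
  split; [pose proof (Cmod_ge_0 (a 0%nat)); lra|].
  intros [|k].
  - simpl. lra.
  - rewrite <- Cmod_pow, <- Cmod_mult.
    replace (a (S k) * w ^ S k)%C
      with ((l - psum a w k) + - (l - psum a w (S k)))%C
      by (rewrite psum_S; ring).
    eapply Rle_trans; [apply Cmod_triangle|]. rewrite Cmod_opp.
    pose proof (HB k); pose proof (HB (S k)); pose proof (Cmod_ge_0 (a 0%nat)); lra.
Qed.

(** Abel's argument: the terms are bounded at [w], and passing to the smaller radius multiplies the
    term of index [k] by [(rho / Cmod w) ^ k]. *)
Lemma psums_geometric (a : nat -> C) (w l : C) (rho : R) :
  psums a w l -> 0 <= rho < Cmod w -> exists M q, geometric a rho M q.
Proof.
  intros Hl Hrho.
  destruct (psums_terms_bounded a w l Hl) as (M & HM & Hk).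
  exists M, (rho / Cmod w). split; [auto|]. split.
  - split; [apply Rdiv_le_0_compat; lra|].
    apply Rmult_lt_reg_r with (Cmod w); [lra|]. field_simplify; lra.
  - intros k.
    assert (Hp : 0 < Cmod w ^ k) by (apply pow_lt; lra).
    replace (Cmod (a k) * rho ^ k)
      with ((Cmod (a k) * Cmod w ^ k) * (rho / Cmod w) ^ k).
    + apply Rmult_le_compat_r; auto. apply pow_le, Rdiv_le_0_compat; lra.
    + unfold Rdiv. rewrite Rpow_mult_distr, pow_inv. field. lra.
Qed.

(** * Parseval's identity on circles *)

Ltac cring := match goal with |- ?x = ?y => change (@eq C x y) end; ring.

Ltac eqR := match goal with |- ?x = ?y => change (@eq R x y) end.

Ltac rring :=
  eqR;
  unfold minus, opp, plus, scal; simpl; unfold mult; simpl; ring.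

Definition cis (t : R) : C := (cos t, sin t).

Lemma Cexp_cis (t : R) : Cexp (Ci * RtoC t) = cis t.
Proof.
  unfold Cexp, cis, Ci, RtoC, Cmult; simpl.
  replace (0 * t - 1 * 0) with 0 by ring. replace (0 * 0 + 1 * t) with t by ring.
  rewrite exp_0. f_equal; ring.
Qed.

Lemma Cmod_cis (t : R) : Cmod (cis t) = 1.
Proof.
  unfold Cmod, cis; simpl fst; simpl snd. rewrite <- !Rsqr_pow2, Rplus_comm, sin2_cos2.
  apply sqrt_1.
Qed.

Lemma cis_pow (t : R) (n : nat) : (cis t ^ n)%C = cis (INR n * t).
Proof.
  induction n as [|n IH].
  - unfold cis; simpl. rewrite Rmult_0_l, cos_0, sin_0. reflexivity.
  - rewrite Cpow_S, IH, S_INR.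
    replace ((INR n + 1) * t) with (t + INR n * t) by ring.
    unfold cis, Cmult; simpl. rewrite cos_plus, sin_plus. f_equal; ring.
Qed.

Lemma cis_conj (t : R) : (cis t * Cconj (cis t))%C = RtoC 1.
Proof. rewrite <- Cmod2_conj, Cmod_cis. now rewrite pow1. Qed.

Lemma Cmod_Rmult_cis (rho t : R) : 0 <= rho -> Cmod (RtoC rho * cis t) = rho.
Proof. intros H. rewrite Cmod_mult, Cmod_cis, Cmod_R, Rabs_pos_eq; lra. Qed.

Lemma is_RInt_trig (m : nat) (al be : R) : (0 < m)%nat ->
  is_RInt (fun t => al * cos (INR m * t) + be * sin (INR m * t)) (- PI) PI 0.
Proof.
  intros Hm. assert (Hm' : INR m <> 0) by (apply not_0_INR; lia).
  set (F := fun t => al * sin (INR m * t) / INR m - be * cos (INR m * t) / INR m).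
  replace 0 with (minus (F PI) (F (- PI))).
  - apply (is_RInt_derive (V := R_CompleteNormedModule)).
    + intros x _. unfold F. auto_derive; [auto|]. field. auto.
    + intros x _. apply (ex_derive_continuous (V := R_NormedModule)). auto_derive. auto.
  - unfold F, minus, plus, opp; simpl.
    replace (INR m * - PI) with (- (INR m * PI)) by ring.
    rewrite sin_neg, cos_neg.
    assert (sin (INR m * PI) = 0) as ->.
    { clear. induction m as [|m IH]; [now rewrite Rmult_0_l, sin_0|].
      rewrite S_INR. replace ((INR m + 1) * PI) with (INR m * PI + PI) by ring.
      rewrite neg_sin, IH. ring. }
    field. auto.
Qed.

Lemma cis_orthogonal (c : C) (j k : nat) : (j < k)%nat ->
  is_RInt (fun t => Re (c * cis t ^ j * Cconj (cis t ^ k))) (- PI) PI 0.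
Proof.
  intros Hjk.
  apply (is_RInt_ext (V := R_NormedModule)
    (fun t => Re c * cos (INR (k - j) * t) + Im c * sin (INR (k - j) * t)));
    [|apply is_RInt_trig; lia].
  intros t _.
  replace k with (j + (k - j))%nat at 3 by lia.
  rewrite Cpow_add_r, Cmult_conj.
  replace (c * cis t ^ j * (Cconj (cis t ^ j) * Cconj (cis t ^ (k - j))))%C
    with (c * (cis t ^ j * Cconj (cis t ^ j)) * Cconj (cis t ^ (k - j)))%C by ring.
  rewrite <- Cmod2_conj, Cmod_pow, Cmod_cis, !pow1, cis_pow.
  destruct c as [x y]; unfold cis, Cconj, Cmult, RtoC, Re, Im; simpl. ring.
Qed.

Lemma psum_cis_orthogonal (a : nat -> C) (rho : R) (c : C) (N k : nat) : (N < k)%nat ->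
  is_RInt (fun t => Re (psum a (RtoC rho * cis t) N * Cconj (c * cis t ^ k)))
    (- PI) PI 0.
Proof.
  intros HNk. induction N as [|N IH].
  - apply (is_RInt_ext (V := R_NormedModule)
      (fun t => Re ((a 0%nat * Cconj c) * cis t ^ 0 * Cconj (cis t ^ k))));
      [|now apply cis_orthogonal].
    intros t _. rewrite psum_O, Cmult_conj. change (cis t ^ 0)%C with (RtoC 1).
    f_equal. cring.
  - apply (is_RInt_ext (V := R_NormedModule)
      (fun t => plus (Re (psum a (RtoC rho * cis t) N * Cconj (c * cis t ^ k)))
        (Re ((a (S N) * RtoC rho ^ S N * Cconj c) * cis t ^ S N * Cconj (cis t ^ k))))).
    + intros t _. change plus with Rplus. rewrite <- re_plus. f_equal.
      rewrite psum_S, Cpow_mult_l, !Cmult_conj. cring.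
    + replace 0 with (plus 0 0) by rring.
      apply (is_RInt_plus (V := R_NormedModule)); [apply IH; lia|].
      now apply cis_orthogonal.
Qed.

Lemma Cmod_plus_sqr (x y : C) :
  Cmod (x + y) ^ 2 = Cmod x ^ 2 + Cmod y ^ 2 + 2 * Re (x * Cconj y).
Proof.
  rewrite !Cmod2_alt. destruct x, y; unfold Re, Im, Cplus, Cmult, Cconj; simpl. ring.
Qed.

(** Pythagoras by induction: the new term has a frequency above all previous ones, so the cross term
    integrates to [0]. *)
Lemma parseval_psum (a : nat -> C) (rho : R) (N : nat) : 0 <= rho ->
  is_RInt (fun t => Cmod (psum a (RtoC rho * cis t) N) ^ 2) (- PI) PI
    (2 * PI * sum_n (fun k => Cmod (a k) ^ 2 * rho ^ (2 * k)) N).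
Proof.
  intros Hrho. induction N as [|N IH].
  - rewrite sum_O.
    apply (is_RInt_ext (V := R_NormedModule) (fun _ => Cmod (a 0%nat) ^ 2)).
    { intros t _. now rewrite psum_O. }
    replace (2 * PI * _) with (scal (PI - - PI) (Cmod (a 0%nat) ^ 2))
      by rring.
    apply (is_RInt_const (V := R_NormedModule)).
  - rewrite sum_Sn.
    set (c := (a (S N) * RtoC rho ^ S N)%C).
    apply (is_RInt_ext (V := R_NormedModule)
      (fun t => plus (plus (Cmod (psum a (RtoC rho * cis t) N) ^ 2)
                 (Cmod (a (S N)) ^ 2 * rho ^ (2 * S N)))
        (scal 2 (Re (psum a (RtoC rho * cis t) N * Cconj (c * cis t ^ S N)))))).
    { intros t _. rewrite psum_S, Cmod_plus_sqr.
      change plus with Rplus. change scal with Rmult. f_equal; [f_equal|].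
      - rewrite Cmod_mult, Cmod_pow, Cmod_Rmult_cis, Rpow_mult_distr, <- !pow_mult by auto.
        now rewrite (Nat.mul_comm 2).
      - unfold c. rewrite Cpow_mult_l. do 4 f_equal. cring. }
    change plus with Rplus.
    replace (2 * PI * (sum_n (fun k => Cmod (a k) ^ 2 * rho ^ (2 * k)) N
        + Cmod (a (S N)) ^ 2 * rho ^ (2 * S N)))
      with (plus (plus (2 * PI * sum_n (fun k => Cmod (a k) ^ 2 * rho ^ (2 * k)) N)
         (scal (PI - - PI) (Cmod (a (S N)) ^ 2 * rho ^ (2 * S N)))) (scal 2 0))
      by rring.
    apply (is_RInt_plus (V := R_NormedModule));
      [apply (is_RInt_plus (V := R_NormedModule))|].
    + exact IH.
    + apply (is_RInt_const (V := R_NormedModule)).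
    + apply (is_RInt_scal (V := R_NormedModule)). apply psum_cis_orthogonal. lia.
Qed.

Lemma Cmod_rev_triangle (x y : C) : Rabs (Cmod x - Cmod y) <= Cmod (x - y).
Proof.
  apply Rabs_le. split.
  - pose proof (Cmod_triangle x (- (x - y))) as H. rewrite Cmod_opp in H.
    replace (x + - (x - y))%C with y in H by ring. lra.
  - pose proof (Cmod_triangle (x - y) y) as H.
    replace (x - y + y)%C with x in H by ring. lra.
Qed.

(** The tail bound does not depend on [t], so the squared moduli converge uniformly and their
    integrals pass to the limit; that limit also yields convergence of the coefficient series. *)
Lemma parseval (a : nat -> C) (rho M q : R) (g : R -> C) :
  0 <= rho -> geometric a rho M q ->
  (forall t, psums a (RtoC rho * cis t) (g t)) ->
  is_RInt (fun t => Cmod (g t) ^ 2) (- PI) PI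
    (2 * PI * Series (fun k => Cmod (a k) ^ 2 * rho ^ (2 * k))) /\
  ex_series (fun k => Cmod (a k) ^ 2 * rho ^ (2 * k)).
Proof.
  intros Hrho Ha Hg.
  set (eps := fun N => M * q ^ S N / (1 - q)).
  assert (Heps : is_lim_seq eps 0) by apply is_lim_seq_geom_tail, Ha.
  assert (Hd : forall N t, Cmod (g t - psum a (RtoC rho * cis t) N) <= eps N).
  { intros N t. apply (psums_tail a rho); auto. rewrite Cmod_Rmult_cis; lra. }
  set (B := Cmod (a 0%nat) + eps 0%nat).
  assert (HB : forall t, Cmod (g t) <= B).
  { intros t. specialize (Hd 0%nat t). rewrite psum_O in Hd. unfold B.
    replace (g t) with (a 0%nat + (g t - a 0%nat))%C by ring.
    eapply Rle_trans; [apply Cmod_triangle|]. lra. }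
  assert (He0 : forall N, 0 <= eps N).
  { intros N. eapply Rle_trans; [apply Cmod_ge_0|apply (Hd N 0)]. }
  assert (HB0 : 0 <= B) by (eapply Rle_trans; [apply Cmod_ge_0|apply (HB 0)]).
  assert (Hdd : forall N t, Rabs (Cmod (psum a (RtoC rho * cis t) N) ^ 2 - Cmod (g t) ^ 2)
                 <= eps N * (2 * B + eps N)).
  { intros N t. set (S := psum a (RtoC rho * cis t) N).
    replace (Cmod S ^ 2 - Cmod (g t) ^ 2)
      with ((Cmod S - Cmod (g t)) * (Cmod S + Cmod (g t))) by ring.
    assert (H1 : Rabs (Cmod S - Cmod (g t)) <= eps N).
    { eapply Rle_trans; [apply Cmod_rev_triangle|].
      rewrite <- Cmod_opp. replace (- (S - g t))%C with (g t - S)%C by ring. apply Hd. }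
    rewrite Rabs_mult. apply Rmult_le_compat; auto using Rabs_pos.
    pose proof (Cmod_ge_0 S). pose proof (Cmod_ge_0 (g t)).
    rewrite Rabs_pos_eq by lra.
    apply Rabs_le_between in H1. specialize (HB t). lra. }
  assert (Hlim : is_lim_seq (fun N => eps N * (2 * B + eps N)) 0).
  { replace (Finite 0) with (Finite (0 * (2 * B + 0))) by (f_equal; ring).
    apply is_lim_seq_mult'; auto. apply is_lim_seq_plus'; auto.
    apply is_lim_seq_const. }
  destruct (filterlim_RInt (V := R_CompleteNormedModule)
     (fun N t => Cmod (psum a (RtoC rho * cis t) N) ^ 2) (- PI) PI
     eventually _ (fun t => Cmod (g t) ^ 2)
     (fun N => 2 * PI * sum_n (fun k => Cmod (a k) ^ 2 * rho ^ (2 * k)) N))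
    as (L & HL1 & HL2).
  - intros N. now apply parseval_psum.
  - intros P [e He]. apply is_lim_seq_spec in Hlim.
    destruct (Hlim e) as [N HN]. exists N. intros n Hn. apply He. intros t.
    change (Rabs (Cmod (psum a (RtoC rho * cis t) n) ^ 2 - Cmod (g t) ^ 2) < e).
    eapply Rle_lt_trans; [apply Hdd|]. specialize (HN n Hn).
    rewrite Rminus_0_r in HN. eapply Rle_lt_trans; [apply Rle_abs|exact HN].
  - pose proof PI_RGT_0 as HPI. simpl in L.
    assert (Hs : is_series (fun k => Cmod (a k) ^ 2 * rho ^ (2 * k)) (L / (2 * PI))).
    { change (is_lim_seq (sum_n (fun k => Cmod (a k) ^ 2 * rho ^ (2 * k))) (L / (2 * PI))).
      apply is_lim_seq_ext with (fun N => / (2 * PI) *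
         (2 * PI * sum_n (fun k => Cmod (a k) ^ 2 * rho ^ (2 * k)) N)).
      { intros n. field. lra. }
      replace (Finite (L / (2 * PI))) with (Rbar_mult (/ (2 * PI)) L)
        by (simpl; f_equal; field; lra).
      now apply is_lim_seq_scal_l. }
    split; [|eexists; exact Hs].
    rewrite (is_series_unique _ _ Hs).
    replace (2 * PI * (L / (2 * PI))) with L by (field; lra). exact HL2.
Qed.

(** No contour integral is needed: by Parseval a single term [Cmod (a n) ^ 2 * rho ^ (2 * n)] is at
    most the mean of the squared modulus of [h], hence at most [B ^ 2]. *)
Lemma cauchy_estimate (a : nat -> C) (r rho B : R) (h : C -> C) (n : nat) :
  0 < rho < r -> (forall w, Cmod w < r -> psums a w (h w)) ->
  (forall w, Cmod w = rho -> Cmod (h w) <= B) ->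
  Cmod (a n) * rho ^ n <= B.
Proof.
  intros Hrho Ha HB.
  assert (Hg : exists M q, geometric a rho M q).
  (* Convergence at a point strictly between [rho] and [r] gives geometric decay at [rho]. *)
  { apply (psums_geometric a (RtoC ((rho + r) / 2)) (h (RtoC ((rho + r) / 2)))).
    - apply Ha. rewrite Cmod_R, Rabs_pos_eq; lra.
    - rewrite Cmod_R, Rabs_pos_eq; lra. }
  destruct Hg as (M & q & Hg).
  destruct (parseval a rho M q (fun t => h (RtoC rho * cis t)%C)) as [HI Hs]; auto; [lra| |].
  { intros t. apply Ha. rewrite Cmod_Rmult_cis; lra. }
  assert (HB0 : 0 <= B).
  { eapply Rle_trans; [apply Cmod_ge_0|]. apply (HB (RtoC rho)).
    rewrite Cmod_R, Rabs_pos_eq; lra. }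
  pose proof PI_RGT_0 as HPI.
  assert (HS : Series (fun k => Cmod (a k) ^ 2 * rho ^ (2 * k)) <= B ^ 2).
  { assert (H2 : 2 * PI * Series (fun k => Cmod (a k) ^ 2 * rho ^ (2 * k))
                 <= (PI - - PI) * B ^ 2).
    { apply (is_RInt_le (fun t => Cmod (h (RtoC rho * cis t)%C) ^ 2) (fun _ => B ^ 2)
        (- PI) PI); [lra|exact HI|apply (is_RInt_const (V := R_NormedModule))|].
      intros t _. apply pow_incr. split; [apply Cmod_ge_0|].
      apply HB. rewrite Cmod_Rmult_cis; lra. }
    apply Rmult_le_reg_l with (2 * PI); lra. }
  assert (Hp : forall k, 0 <= Cmod (a k) ^ 2 * rho ^ (2 * k)).
  { intros k. apply Rmult_le_pos; apply pow_le; [apply Cmod_ge_0|lra]. }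
  assert (Hn : Cmod (a n) ^ 2 * rho ^ (2 * n) <= B ^ 2).
  { eapply Rle_trans; [|exact HS].
    apply Rle_trans with (sum_n (fun k => Cmod (a k) ^ 2 * rho ^ (2 * k)) n).
    - destruct n as [|n]; [rewrite sum_O; lra|]. rewrite sum_Sn.
      change plus with Rplus. rewrite <- (Rplus_0_l (Cmod (a (S n)) ^ 2 * _)) at 1.
      apply Rplus_le_compat_r. rewrite sum_n_Reals. now apply cond_pos_sum.
    - apply is_lim_seq_incr_compare; [apply Series_correct in Hs; exact Hs|].
      intros k. rewrite sum_Sn. change plus with Rplus. specialize (Hp (S k)). lra. }
  apply Rsqr_incr_0_var; auto. rewrite !Rsqr_pow2, Rpow_mult_distr, <- pow_mult.
  now rewrite (Nat.mul_comm n).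
Qed.

(** The difference of the two series sums to zero, so Cauchy's estimate applies to it with bound
    [0]. *)
Lemma psums_coeff_unique (a b : nat -> C) (r : R) (h : C -> C) (n : nat) :
  0 < r -> (forall w, Cmod w < r -> psums a w (h w)) ->
  (forall w, Cmod w < r -> psums b w (h w)) -> a n = b n.
Proof.
  intros Hr Ha Hb.
  assert (H : Cmod (a n - b n) * (r / 2) ^ n <= 0).
  { apply (cauchy_estimate (fun k => a k - b k)%C r (r / 2) 0 (fun w => h w - h w)%C);
      [lra| |].
    - intros w Hw. apply psums_minus; auto.
    - intros w _. replace (h w - h w)%C with (RtoC 0) by ring. rewrite Cmod_0. lra. }
  assert (Hp : 0 < (r / 2) ^ n) by (apply pow_lt; lra).
  assert (H0 : Cmod (a n - b n) = 0).
  { apply Rle_antisym; [|apply Cmod_ge_0].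
    apply Rmult_le_reg_r with ((r / 2) ^ n); lra. }
  apply Cmod_eq_0 in H0. replace (a n) with ((a n - b n) + b n)%C by ring.
  rewrite H0. ring.
Qed.

(** * Strict complex differentiability *)

(** Both endpoints of the increment vary near [z]. If this holds at every point, the derivative is
    continuous ([strict_deriv_continuous]), which differentiation under the integral sign
    requires. *)
Definition strict_deriv (f : C -> C) (z l : C) : Prop :=
  forall eps, 0 < eps -> exists delta, 0 < delta /\
    forall u v, Cmod (u - z) < delta -> Cmod (v - z) < delta ->
      Cmod (f u - f v - l * (u - v)) <= eps * Cmod (u - v).

Lemma Cpow_diff_le (u v : C) (rho : R) (n : nat) :
  Cmod u <= rho -> Cmod v <= rho ->
  Cmod (u ^ S n - v ^ S n) <= INR (S n) * rho ^ n * Cmod (u - v).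
Proof.
  intros Hu Hv. induction n as [|n IH].
  - simpl. rewrite !Cmult_1_r. lra.
  - replace (u ^ S (S n) - v ^ S (S n))%C
      with (u ^ S n * (u - v) + (u ^ S n - v ^ S n) * v)%C
      by (rewrite !(Cpow_S _ (S n)); ring).
    eapply Rle_trans; [apply Cmod_triangle|]. rewrite !Cmod_mult, Cmod_pow.
    assert (H1 : Cmod u ^ S n <= rho ^ S n)
      by (apply pow_incr; split; [apply Cmod_ge_0|auto]).
    replace (INR (S (S n)) * rho ^ S n * Cmod (u - v)) with
      (rho ^ S n * Cmod (u - v) + INR (S n) * rho ^ n * Cmod (u - v) * rho)
      by (rewrite (S_INR (S n)); simpl; ring).
    apply Rplus_le_compat.
    + apply Rmult_le_compat_r; [apply Cmod_ge_0|auto].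
    + apply Rmult_le_compat; auto using Cmod_ge_0.
Qed.

(** Absorbs the degree produced by [Cpow_diff_le] into a doubled radius. *)
Lemma INR_S_le_pow2 (n : nat) : INR (S n) <= 2 ^ n.
Proof.
  induction n as [|n IH]; [simpl; lra|]. rewrite S_INR. simpl (2 ^ S n).
  assert (1 <= 2 ^ n) by (apply pow_R1_Rle; lra). lra.
Qed.

(** Past the linear part, the term of degree [k] contributes at most [Cmod (u - v) * (M / s) * (2 *
    rho / s) ^ (k - 1)]. One factor [2 * rho / s] is kept, since it becomes small with [rho]; the
    others are at most [/ 2] and add up to [2 * (1 - (/ 2) ^ N)]. *)
Lemma psum_strict_le (a : nat -> C) (s M rho : R) (u v : C) (N : nat) :
  0 < s -> 0 <= M -> (forall k, Cmod (a k) * s ^ k <= M) -> 4 * rho <= s ->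
  Cmod u <= rho -> Cmod v <= rho ->
  Cmod (psum a u (S N) - psum a v (S N) - a 1%nat * (u - v))
  <= Cmod (u - v) * (M / s) * (2 * rho / s) * (2 * (1 - (/ 2) ^ N)).
Proof.
  intros Hs HM Ha Hrho Hu Hv.
  assert (Hr0 : 0 <= rho) by (eapply Rle_trans; [apply Cmod_ge_0|exact Hu]).
  induction N as [|N IH].
  - rewrite !psum_S, !psum_O.
    replace (a 0%nat + a 1%nat * u ^ 1 - (a 0%nat + a 1%nat * v ^ 1) - a 1%nat * (u - v))%C
      with (RtoC 0) by ring.
    rewrite Cmod_0. simpl. right. ring.
  - rewrite (psum_S a u (S N)), (psum_S a v (S N)).
    replace (psum a u (S N) + a (S (S N)) * u ^ S (S N)
             - (psum a v (S N) + a (S (S N)) * v ^ S (S N)) - a 1%nat * (u - v))%C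
      with ((psum a u (S N) - psum a v (S N) - a 1%nat * (u - v))
            + a (S (S N)) * (u ^ S (S N) - v ^ S (S N)))%C by ring.
    eapply Rle_trans; [apply Cmod_triangle|]. rewrite Cmod_mult.
    assert (Hx : 0 <= 2 * rho / s <= / 2).
    { split; [apply Rdiv_le_0_compat; lra|].
      apply Rmult_le_reg_r with s; auto. field_simplify; lra. }
    assert (Ht : Cmod (a (S (S N))) * Cmod (u ^ S (S N) - v ^ S (S N))
                 <= Cmod (u - v) * (M / s) * (2 * rho / s) * (/ 2) ^ N).
    { apply Rle_trans with (Cmod (a (S (S N))) * (2 ^ S N * rho ^ S N * Cmod (u - v))).
      { apply Rmult_le_compat_l; [apply Cmod_ge_0|].
        eapply Rle_trans; [apply (Cpow_diff_le u v rho); auto|].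
        apply Rmult_le_compat_r; [apply Cmod_ge_0|].
        apply Rmult_le_compat_r; [now apply pow_le|apply INR_S_le_pow2]. }
      apply Rle_trans with (Cmod (u - v) * (M / s) * (2 * rho / s) ^ S N).
      - replace (Cmod (a (S (S N))) * (2 ^ S N * rho ^ S N * Cmod (u - v)))
          with (Cmod (u - v) * (Cmod (a (S (S N))) * s ^ S (S N) / s) * (2 * rho / s) ^ S N).
        + apply Rmult_le_compat_r; [apply pow_le; lra|].
          apply Rmult_le_compat_l; [apply Cmod_ge_0|].
          apply Rmult_le_compat_r; [left; now apply Rinv_0_lt_compat|apply Ha].
        + change (s ^ S (S N)) with (s * s ^ S N). generalize (S N); intros n.
          unfold Rdiv. rewrite !Rpow_mult_distr, pow_inv. field.
          split; [apply pow_nonzero|]; lra.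
      - simpl ((2 * rho / s) ^ S N). rewrite <- Rmult_assoc.
        apply Rmult_le_compat_l; [|apply pow_incr; auto].
        apply Rmult_le_pos; [|apply Hx]. apply Rmult_le_pos; [apply Cmod_ge_0|].
        apply Rdiv_le_0_compat; lra. }
    simpl ((/ 2) ^ S N). lra.
Qed.

Lemma taylor_coeffs_strict_deriv (f : C -> C) (z : C) (a : nat -> C) :
  taylor_coeffs f z a -> strict_deriv f z (a 1%nat).
Proof.
  intros (r & Hr & Hf) eps Heps.
  destruct (psums_terms_bounded a (RtoC (r / 2)) (f (z + RtoC (r / 2))%C)) as (M & HM & Ha).
  { apply psums_is_pseries, Hf. rewrite Cmod_R, Rabs_pos_eq; lra. }
  rewrite Cmod_R, Rabs_pos_eq in Ha by lra.
  set (s := r / 2) in *. assert (Hs : 0 < s) by (unfold s; lra).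
  (* The first bound is the condition [4 * rho <= s] of [psum_strict_le] at [rho = delta]; the
     second brings its constant [4 * M * delta / s ^ 2] below [eps]. Using [M + 1] avoids dividing
     by zero. *)
  set (delta := Rmin (s / 4) (eps / (4 * (M + 1)) * s ^ 2)).
  assert (Hd : 0 < delta).
  { apply Rmin_glb_lt; [lra|]. apply Rmult_lt_0_compat; [|apply pow_lt; lra].
    apply Rdiv_lt_0_compat; lra. }
  assert (Hd1 : delta <= s / 4) by apply Rmin_l.
  assert (Hd2 : (M / s) * (2 * delta / s) * 2 <= eps).
  { apply Rle_trans with ((M + 1) / s * (2 * (eps / (4 * (M + 1)) * s ^ 2) / s) * 2).
    - apply Rmult_le_compat_r; [lra|]. apply Rmult_le_compat.
      + apply Rdiv_le_0_compat; lra.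
      + apply Rdiv_le_0_compat; lra.
      + apply Rmult_le_compat_r; [left; now apply Rinv_0_lt_compat|lra].
      + apply Rmult_le_compat_r; [left; now apply Rinv_0_lt_compat|].
        apply Rmult_le_compat_l; [lra|apply Rmin_r].
    - right. field. lra. }
  exists delta. split; auto. intros u v Hu Hv.
  assert (Hlim : forall x, Cmod (x - z) < delta -> psums a (x - z)%C (f x)).
  { intros x Hx. apply psums_is_pseries. replace x with (z + (x - z))%C at 2 by ring.
    apply Hf. unfold s in Hd1. lra. }
  (* The polynomial estimate is uniform in [N], so it survives [N -> oo], the two truncation errors
     vanishing. *)
  apply (is_lim_seq_le (fun _ => Cmod (f u - f v - a 1%nat * (u - v)))
    (fun N => (Cmod (f u - psum a (u - z)%C (S N)) + Cmod (f v - psum a (v - z)%C (S N)))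
              + eps * Cmod (u - v))
    (Cmod (f u - f v - a 1%nat * (u - v))) (eps * Cmod (u - v))).
  - intros N.
    replace (f u - f v - a 1%nat * (u - v))%C
      with (((f u - psum a (u - z)%C (S N)) + - (f v - psum a (v - z)%C (S N)))
        + (psum a (u - z)%C (S N) - psum a (v - z)%C (S N) - a 1%nat * ((u - z) - (v - z))))%C
      by ring.
    eapply Rle_trans; [apply Cmod_triangle|]. apply Rplus_le_compat.
    { eapply Rle_trans; [apply Cmod_triangle|]. rewrite Cmod_opp. lra. }
    eapply Rle_trans; [apply (psum_strict_le a s M delta); auto; lra|].
    replace ((u - z) - (v - z))%C with (u - v)%C by ring.
    apply Rle_trans with (Cmod (u - v) * ((M / s) * (2 * delta / s) * 2)).
    + rewrite !Rmult_assoc. apply Rmult_le_compat_l; [apply Cmod_ge_0|].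
      rewrite <- !Rmult_assoc. rewrite <- (Rmult_1_r (M / s * _ * 2)) at 2.
      apply Rmult_le_compat_l.
      * apply Rmult_le_pos; [|lra]. apply Rmult_le_pos; apply Rdiv_le_0_compat; lra.
      * assert (0 <= (/ 2) ^ N) by (apply pow_le; lra). lra.
    + rewrite Rmult_comm. apply Rmult_le_compat_r; [apply Cmod_ge_0|auto].
  - apply is_lim_seq_const.
  - replace (Finite (eps * Cmod (u - v))) with (Finite (0 + 0 + eps * Cmod (u - v)))
      by (f_equal; ring).
    apply is_lim_seq_plus'; [|apply is_lim_seq_const].
    apply is_lim_seq_plus'.
    + apply (is_lim_seq_incr_1 (fun N => Cmod (f u - psum a (u - z)%C N))), Hlim, Hu.
    + apply (is_lim_seq_incr_1 (fun N => Cmod (f v - psum a (v - z)%C N))), Hlim, Hv.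
Qed.

(** Expansions are only known to exist point by point; [epsilon] gathers the derivatives into one
    function. *)
Lemma entire_strict_deriv (f : C -> C) :
  entire f -> exists f', forall z, strict_deriv f z (f' z).
Proof.
  intros Hf.
  exists (fun z => epsilon (inhabits (RtoC 0)) (strict_deriv f z)). intros z.
  apply epsilon_spec. destruct (Hf z) as [a Ha]. exists (a 1%nat). now apply taylor_coeffs_strict_deriv.
Qed.

Lemma strict_deriv_const (z c : C) : strict_deriv (fun _ => c) z 0%C.
Proof.
  intros eps Heps. exists 1. split; [lra|]. intros u v _ _.
  replace (c - c - 0 * (u - v))%C with (RtoC 0) by ring. rewrite Cmod_0.
  apply Rmult_le_pos; [lra|apply Cmod_ge_0].
Qed.

Lemma strict_deriv_scal (f : C -> C) (z l c : C) :
  strict_deriv f z l -> strict_deriv (fun z => c * f z)%C z (c * l)%C.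
Proof.
  intros Hf eps Heps.
  assert (Hc : 0 < Cmod c + 1) by (pose proof (Cmod_ge_0 c); lra).
  destruct (Hf (eps / (Cmod c + 1))) as (d & Hd & Hfd); [now apply Rdiv_lt_0_compat|].
  exists d. split; auto. intros u v Hu Hv. specialize (Hfd u v Hu Hv).
  replace (c * f u - c * f v - c * l * (u - v))%C
    with (c * (f u - f v - l * (u - v)))%C by ring.
  rewrite Cmod_mult.
  apply Rle_trans with ((Cmod c + 1) * (eps / (Cmod c + 1) * Cmod (u - v))).
  - apply Rmult_le_compat; auto using Cmod_ge_0; lra.
  - right. field. lra.
Qed.

(** One and the same difference quotient, between [u] and [u + h], is close to [f' z] by strictness
    at [z] and to [f' u] by differentiability at [u]. *)
Lemma strict_deriv_continuous (f f' : C -> C) (z : C) (eps : R) :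
  (forall z, strict_deriv f z (f' z)) -> 0 < eps ->
  exists delta, 0 < delta /\ forall u, Cmod (u - z) < delta -> Cmod (f' u - f' z) < eps.
Proof.
  intros Hf Heps.
  destruct (Hf z (eps / 4)) as (d & Hd & Hz); [lra|].
  exists d. split; auto. intros u Hu.
  destruct (Hf u (eps / 4)) as (e & He & Huu); [lra|].
  (* Small enough to keep [u + h] within [e] of [u] and still within [d] of [z]. *)
  set (h := Rmin (e / 2) ((d - Cmod (u - z)) / 2)).
  assert (Hh : 0 < h) by (apply Rmin_glb_lt; lra).
  assert (h <= e / 2) by apply Rmin_l.
  assert (h <= (d - Cmod (u - z)) / 2) by apply Rmin_r.
  assert (Hm : Cmod h = h) by (rewrite Cmod_R, Rabs_pos_eq; lra).
  assert (H1 := Hz (u + h)%C u).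
  assert (H2 := Huu (u + h)%C u).
  replace (u + h - u)%C with (RtoC h) in * by ring. rewrite Hm in *.
  replace (u - u)%C with (RtoC 0) in * by ring. rewrite Cmod_0 in *.
  assert (H3 : Cmod (u + h - z) < d).
  { replace (u + h - z)%C with ((u - z) + h)%C by ring.
    eapply Rle_lt_trans; [apply Cmod_triangle|]. rewrite Hm. lra. }
  specialize (H1 H3 Hu). specialize (H2 ltac:(lra) He).
  apply Rmult_lt_reg_r with h; auto.
  rewrite <- Hm at 1. rewrite <- Cmod_mult.
  replace ((f' u - f' z) * h)%C
    with ((f (u + h) - f u - f' z * h) + - (f (u + h) - f u - f' u * h))%C by ring.
  eapply Rle_lt_trans; [apply Cmod_triangle|]. rewrite Cmod_opp.
  assert (0 < eps * h) by now apply Rmult_lt_0_compat. lra.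
Qed.

Lemma Cmod_le_2Rmax (x : C) : Cmod x <= 2 * Rmax (Rabs (fst x)) (Rabs (snd x)).
Proof.
  eapply Rle_trans; [apply Cmod_2Rmax|]. apply Rmult_le_compat_r.
  - eapply Rle_trans; [apply Rabs_pos|apply Rmax_l].
  - replace 2 with (sqrt 4) at 2 by (replace 4 with (2 ^ 2) by ring; apply sqrt_pow2; lra).
    apply sqrt_le_1; lra.
Qed.

(** Half of the Cauchy-Riemann equations: as a function of two real variables, the real part of [f]
    has differential [(Re l, - Im l)], and the two-variable chain rule finishes. *)
Lemma is_derive_Re_path (f : C -> C) (p : R -> C) (t a b : R) (l : C) :
  strict_deriv f (p t) l ->
  is_derive (fun t => Re (p t)) t a -> is_derive (fun t => Im (p t)) t b ->
  is_derive (fun t => Re (f (p t))) t (Re (l * (a, b))).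
Proof.
  intros Hf Ha Hb.
  apply is_derive_Reals in Ha, Hb. apply is_derive_Reals.
  assert (Hp : forall s, p s = (Re (p s), Im (p s))) by (intros s; now destruct (p s)).
  assert (H : derivable_pt_lim (fun s => Re (f (Re (p s), Im (p s)))) t
                (Re l * a + - Im l * b)).
  { apply (derivable_pt_lim_comp_2d (fun x y => Re (f (x, y)))
             (fun s => Re (p s)) (fun s => Im (p s))); auto.
    intros eps. rewrite Hp in Hf.
    (* Halving [eps] here and [d] below pays for the factor [2] between the modulus and the max
       norm. *)
    destruct (Hf (eps / 2)) as (d & Hd & Hfd); [destruct eps; simpl; lra|].
    assert (Hd2 : 0 < d / 2) by lra.
    exists (mkposreal _ Hd2). simpl. intros u v Hu Hv.
    set (z := (Re (p t), Im (p t))) in *.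
    assert (Hw : Cmod ((u, v) - z) <= 2 * Rmax (Rabs (u - Re (p t))) (Rabs (v - Im (p t))))
      by apply (Cmod_le_2Rmax ((u, v) - z)%C).
    assert (Hdist : Cmod ((u, v) - z) < d).
    { eapply Rle_lt_trans; [exact Hw|].
      assert (Rmax (Rabs (u - Re (p t))) (Rabs (v - Im (p t))) < d / 2)
        by now apply Rmax_lub_lt. lra. }
    assert (H0 := Hfd (u, v) z Hdist). replace (z - z)%C with (RtoC 0) in H0 by ring.
    rewrite Cmod_0 in H0. specialize (H0 Hd).
    replace (Re (f (u, v)) - Re (f z) - (Re l * (u - Re (p t)) + - Im l * (v - Im (p t))))
      with (Re (f (u, v) - f z - l * ((u, v) - z))%C).
    - eapply Rle_trans; [apply re_le_Cmod|]. eapply Rle_trans; [exact H0|].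
      apply Rle_trans with (eps / 2 * (2 * Rmax (Rabs (u - Re (p t))) (Rabs (v - Im (p t)))));
        [|right; field].
      apply Rmult_le_compat_l; auto. destruct eps; simpl; lra.
    - unfold z, Re, Im. destruct l, (f (u, v)), (f (fst (p t), snd (p t))); simpl. ring. }
  replace (Re (l * (a, b))) with (Re l * a + - Im l * b)
    by (destruct l; unfold Re, Im; simpl; ring).
  assert (E : forall s, f (p s) = f (Re (p s), Im (p s))) by (intros s; now rewrite <- Hp).
  intros eps Heps. destruct (H eps Heps) as [d Hd]. exists d. intros h Hh0 Hh.
  rewrite (E t), (E (t + h)). now apply Hd.
Qed.

(** * Cauchy's integral formula *)

Lemma is_derive_0_const (h : R -> R) :
  (forall s, is_derive h s 0) -> h 1 = h 0.
Proof.
  intros Hh. destruct (MVT_gen h 0 1 (fun _ => 0)) as (c & _ & Hc); [auto| |lra].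
  intros x _. apply continuity_pt_filterlim.
  apply (ex_derive_continuous (V := R_NormedModule) h). now exists 0.
Qed.

(** Lets every result below be proved for real parts only: the imaginary part of [f] is handled by
    applying it to [- Ci * f]. *)
Lemma Im_Re_Ci (z : C) : Im z = Re (- Ci * z).
Proof. destruct z; unfold Im, Re, Ci; simpl; ring. Qed.

Lemma continuity_2d_Re_comp (F : C -> C) (X Y : R -> R -> R) (s t : R) :
  (forall eps, 0 < eps -> exists delta, 0 < delta /\
     forall u, Cmod (u - (X s t, Y s t)) < delta -> Cmod (F u - F (X s t, Y s t)) < eps) ->
  continuity_2d_pt X s t -> continuity_2d_pt Y s t ->
  continuity_2d_pt (fun s t => Re (F (X s t, Y s t))) s t.
Proof.
  intros HF HX HY eps.
  destruct (HF eps (cond_pos eps)) as (d & Hd & HFd).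
  assert (Hd2 : 0 < d / 2) by lra.
  generalize (locally_2d_and _ _ _ _ (HX (mkposreal _ Hd2)) (HY (mkposreal _ Hd2))).
  apply locally_2d_impl, locally_2d_forall. simpl. intros u v [H1 H2].
  eapply Rle_lt_trans; [|apply (HFd (X u v, Y u v))].
  - eapply Rle_trans; [|apply re_le_Cmod].
    right. reflexivity.
  - eapply Rle_lt_trans; [apply Cmod_le_2Rmax|]. simpl.
    assert (Rmax (Rabs (X u v - X s t)) (Rabs (Y u v - Y s t)) < d / 2)
      by now apply Rmax_lub_lt.
    unfold Rminus in *. lra.
Qed.

Lemma continuity_2d_pt_snd (h : R -> R) (s t : R) :
  continuity_pt h t -> continuity_2d_pt (fun _ t => h t) s t.
Proof.
  intros Hh eps. destruct (Hh eps (cond_pos eps)) as (d & Hd & H).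
  exists (mkposreal _ Hd). simpl. intros u v _ Hv.
  destruct (Req_dec t v) as [<-|Hne].
  - rewrite Rminus_diag, Rabs_R0. apply cond_pos.
  - apply H. split; auto. split; [exact I|auto].
Qed.

Section CauchyFormula.

Variables (f f' : C -> C).
Hypothesis Hf : forall z, strict_deriv f z (f' z).
Variables (w : C) (r : R).
Hypothesis Hw : Cmod w < r.

Let zeta (t : R) : C := (RtoC r * cis t)%C.
(** The homotopy: the circle itself at [s = 1], the constant point [w] at [s = 0]. *)
Let path (s t : R) : C := (w + RtoC s * (zeta t - w))%C.

Lemma Re_path (s t : R) : Re (path s t) = Re w + s * (r * cos t - Re w).
Proof. unfold path, zeta, cis, Re; destruct w; simpl. ring. Qed.

Lemma Im_path (s t : R) : Im (path s t) = Im w + s * (r * sin t - Im w).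
Proof. unfold path, zeta, cis, Im; destruct w; simpl. ring. Qed.

Lemma zeta_neq (t : R) : (zeta t - w)%C <> 0%C.
Proof.
  intros H0. assert (H : Cmod (zeta t) = Cmod w).
  { f_equal. replace (zeta t) with ((zeta t - w) + w)%C by ring. rewrite H0. ring. }
  unfold zeta in H. rewrite Cmod_Rmult_cis in H; [lra|].
  pose proof (Cmod_ge_0 w); lra.
Qed.

(** The Cauchy kernel [dz / (2 i PI (z - w))] on the circle, where [dz = i zeta dt], without its
    factor [1 / (2 PI)]. *)
Let k (t : R) : C := (zeta t / (zeta t - w))%C.
Let G (s t : R) : R := Re (k t * f (path s t))%C.
Let D (s t : R) : R := Re (zeta t * f' (path s t))%C.

(** The velocity [zeta t - w] of the homotopy cancels the denominator of the kernel. *)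
Lemma is_derive_G (s t : R) : is_derive (fun s => G s t) s (D s t).
Proof.
  unfold G, D.
  replace (zeta t * f' (path s t))%C
    with ((k t * f' (path s t)) * (Re (zeta t - w), Im (zeta t - w)))%C.
  - apply (is_derive_Re_path (fun z => k t * f z)%C (fun s => path s t)).
    + now apply strict_deriv_scal.
    + apply (is_derive_ext (fun s => Re w + s * (r * cos t - Re w))).
      { intros x. symmetry. apply Re_path. }
      auto_derive; auto. unfold zeta, cis, Re; destruct w; simpl. ring.
    + apply (is_derive_ext (fun s => Im w + s * (r * sin t - Im w))).
      { intros x. symmetry. apply Im_path. }
      auto_derive; auto. unfold zeta, cis, Im; destruct w; simpl. ring.
  - replace (Re (zeta t - w), Im (zeta t - w)) with (zeta t - w)%C
      by (now destruct (zeta t - w)%C).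
    unfold k. field. apply zeta_neq.
Qed.

Lemma is_derive_f_zeta (c : C) (s t : R) :
  is_derive (fun t => Re (c * f (path s t))%C) t
    (Re (c * f' (path s t) * (RtoC s * Ci * zeta t)))%C.
Proof.
  replace (RtoC s * Ci * zeta t)%C with (s * (r * - sin t), s * (r * cos t))
    by (unfold zeta, cis, Ci, RtoC, Cmult; simpl; f_equal; ring).
  apply (is_derive_Re_path (fun z => c * f z)%C (fun t => path s t)).
  - now apply strict_deriv_scal.
  - apply (is_derive_ext (fun t => Re w + s * (r * cos t - Re w))).
    { intros x. symmetry. apply Re_path. }
    auto_derive; auto. ring.
  - apply (is_derive_ext (fun t => Im w + s * (r * sin t - Im w))).
    { intros x. symmetry. apply Im_path. }
    auto_derive; auto. ring.
Qed.

Lemma continuity_2d_D (s t : R) : continuity_2d_pt D s t.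
Proof.
  set (X := fun s t => Re w + s * (r * cos t - Re w)).
  set (Y := fun s t => Im w + s * (r * sin t - Im w)).
  assert (HX : continuity_2d_pt X s t).
  { unfold X. apply continuity_2d_pt_plus; [apply continuity_2d_pt_const|].
    apply continuity_2d_pt_mult; [apply continuity_2d_pt_id1|].
    apply (continuity_2d_pt_snd (fun t => r * cos t - Re w)).
    apply derivable_continuous_pt. reg. }
  assert (HY : continuity_2d_pt Y s t).
  { unfold Y. apply continuity_2d_pt_plus; [apply continuity_2d_pt_const|].
    apply continuity_2d_pt_mult; [apply continuity_2d_pt_id1|].
    apply (continuity_2d_pt_snd (fun t => r * sin t - Im w)).
    apply derivable_continuous_pt. reg. }
  apply (continuity_2d_pt_ext
    (fun s t => r * cos t * Re (f' (X s t, Y s t))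
      + - (r * sin t) * Re ((- Ci) * f' (X s t, Y s t))%C)).
  - intros x y. unfold D.
    replace (path x y) with (X x y, Y x y).
    + rewrite <- Im_Re_Ci. unfold zeta, cis, Re, Im. simpl. ring.
    + rewrite (surjective_pairing (path x y)).
      change (fst (path x y)) with (Re (path x y)).
      change (snd (path x y)) with (Im (path x y)). now rewrite Re_path, Im_path.
  - apply continuity_2d_pt_plus; apply continuity_2d_pt_mult.
    + apply (continuity_2d_pt_snd (fun t => r * cos t)).
      apply derivable_continuous_pt. reg.
    + apply (continuity_2d_Re_comp f' X Y); auto.
      intros eps Heps. now apply (strict_deriv_continuous f).
    + apply (continuity_2d_pt_snd (fun t => - (r * sin t))).
      apply derivable_continuous_pt. reg.
    + apply (continuity_2d_Re_comp (fun z => - Ci * f' z)%C X Y); auto.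
      intros eps Heps.
      apply (strict_deriv_continuous (fun z => - Ci * f z)%C (fun z => - Ci * f' z)%C); auto.
      intros z. now apply strict_deriv_scal.
Qed.

Lemma continuous_G (s t : R) : continuous (G s) t.
Proof.
  assert (Hd : forall x c, ex_derive (fun t => Re (c * f (path x t)))%C t)
    by (intros x c; eexists; apply is_derive_f_zeta).
  assert (Hk : ex_derive (fun t => Re (k t)) t /\ ex_derive (fun t => Im (k t)) t).
  (* The squared modulus of [zeta t - w], common denominator of the real and imaginary parts of
     [k]. *)
  { set (q := fun t => (r * cos t - Re w) ^ 2 + (r * sin t - Im w) ^ 2).
    assert (Hq : forall t, q t <> 0).
    { intros x Hx. apply (zeta_neq x), Cmod_eq_0.
      assert (H : Cmod (zeta x - w) ^ 2 = 0).
      { rewrite Cmod2_alt, <- Hx. unfold q, zeta, cis, Re, Im; destruct w; simpl. ring. }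
      apply Rsqr_0_uniq. now rewrite Rsqr_pow2. }
    split.
    - apply (ex_derive_ext (fun t =>
        (r * cos t * (r * cos t - Re w) + r * sin t * (r * sin t - Im w)) / q t)).
      { intros x. specialize (Hq x). unfold q, k, zeta, cis, Re, Im in *; destruct w; simpl in *.
        field. intros E; apply Hq; rewrite <- E; ring. }
      specialize (Hq t). unfold q in *. auto_derive. auto.
    - apply (ex_derive_ext (fun t =>
        (r * sin t * (r * cos t - Re w) - r * cos t * (r * sin t - Im w)) / q t)).
      { intros x. specialize (Hq x). unfold q, k, zeta, cis, Re, Im in *; destruct w; simpl in *.
        field. intros E; apply Hq; rewrite <- E; ring. }
      specialize (Hq t). unfold q in *. auto_derive. auto. }
  apply (ex_derive_continuous (V := R_NormedModule)).
  apply (ex_derive_ext (fun t => Re (k t) * Re (1 * f (path s t))%C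
     - Im (k t) * Re (- Ci * f (path s t))%C)).
  { intros x. rewrite <- Im_Re_Ci. unfold G, Re, Im. simpl. ring. }
  destruct Hk as [Hk1 Hk2].
  apply (ex_derive_minus (V := R_NormedModule)); now apply ex_derive_mult.
Qed.

(* For [s <> 0], [D s] is the [t]-derivative of
   [Re (- i / s * f (w + s (zeta t - w)))], which is [2 PI]-periodic. *)
Lemma is_RInt_D (s : R) : is_RInt (D s) (- PI) PI 0.
Proof.
  assert (HDc : forall s t, continuous (D s) t).
  { intros x t. apply continuity_pt_filterlim. intros eps Heps.
    destruct (continuity_2d_D x t (mkposreal _ Heps)) as [d Hd].
    exists d. split; [apply cond_pos|]. intros y [_ Hy]. apply Hd; auto.
    rewrite Rminus_diag, Rabs_R0. apply cond_pos. }
  destruct (Req_dec s 0) as [->|Hs].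
  - apply (is_RInt_ext (V := R_NormedModule)
      (fun t => (r * Re (f' w)) * cos (INR 1 * t) + (- r * Im (f' w)) * sin (INR 1 * t))).
    { intros t _. unfold D. replace (path 0 t) with w by (unfold path; ring).
      simpl INR. rewrite Rmult_1_l. unfold zeta, cis, Re, Im. simpl. ring. }
    apply is_RInt_trig. lia.
  - set (P := fun t => Re (- Ci / RtoC s * f (path s t))%C).
    replace 0 with (minus (P PI) (P (- PI))).
    + apply (is_RInt_derive (V := R_CompleteNormedModule)).
      * intros t _. unfold D.
        replace (zeta t * f' (path s t))%C
          with (- Ci / RtoC s * f' (path s t) * (RtoC s * Ci * zeta t))%C.
        { apply is_derive_f_zeta. }
        replace (- Ci / RtoC s * f' (path s t) * (RtoC s * Ci * zeta t))%C
          with ((- (Ci * Ci)) * (/ RtoC s * RtoC s) * zeta t * f' (path s t))%C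
          by (unfold Cdiv; ring).
        rewrite Cinv_l by (intros E; apply Hs; now injection E).
        replace (- (Ci * Ci))%C with (RtoC 1)
          by (unfold Ci, RtoC, Cmult, Copp; simpl; f_equal; ring). ring.
      * intros t _. apply HDc.
    + unfold P, path, zeta, cis. rewrite cos_neg, sin_neg, sin_PI, Ropp_0.
      apply (minus_eq_zero (G := R_AbelianGroup)).
Qed.

(** Homotopy invariance: the [s]-derivative of the integral of [G s] is the integral of [D s], which
    is [0]. At [s = 0] the value [f w] factors out of the integrand. *)
Lemma RInt_G_const : RInt (G 1) (- PI) PI = RInt (G 0) (- PI) PI.
Proof.
  apply (is_derive_0_const (fun s => RInt (G s) (- PI) PI)). intros s.
    assert (HE : forall u v, Derive (fun z => G z v) u = D u v)
      by (intros u v; apply is_derive_unique, is_derive_G).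
    replace 0 with (RInt (fun t => Derive (fun u => G u t) s) (- PI) PI).
    - apply (is_derive_RInt_param G).
      + apply filter_forall. intros x t _. eexists. apply is_derive_G.
      + intros t _. apply continuity_2d_pt_ext with D; [|apply continuity_2d_D].
        intros u v. symmetry. apply HE.
      + apply filter_forall. intros x.
        apply (ex_RInt_continuous (V := R_CompleteNormedModule)).
        intros t _. apply continuous_G.
    - rewrite (RInt_ext _ (D s)) by (intros; apply HE).
      apply is_RInt_unique, is_RInt_D.
Qed.

End CauchyFormula.

(** * Means of complex-valued functions over the circle *)

Definition Ccont (g : R -> C) : Prop :=
  forall t, continuous (fun t => Re (g t)) t /\ continuous (fun t => Im (g t)) t.

Definition mean (g : R -> C) : C :=
  (RInt (fun t => Re (g t)) (- PI) PI / (2 * PI),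
   RInt (fun t => Im (g t)) (- PI) PI / (2 * PI)).

Lemma Ccont_ext (g h : R -> C) : (forall t, g t = h t) -> Ccont g -> Ccont h.
Proof.
  intros E Hg t. destruct (Hg t) as [H1 H2].
  split; [revert H1|revert H2]; apply continuous_ext; intros x; now rewrite E.
Qed.

Lemma Ccont_const (c : C) : Ccont (fun _ => c).
Proof. intros t; split; apply continuous_const. Qed.

Lemma Ccont_plus (g h : R -> C) :
  Ccont g -> Ccont h -> Ccont (fun t => g t + h t)%C.
Proof.
  intros Hg Hh t. destruct (Hg t), (Hh t).
  split; now apply (continuous_plus (V := R_NormedModule)).
Qed.

Lemma Ccont_mult (g h : R -> C) :
  Ccont g -> Ccont h -> Ccont (fun t => g t * h t)%C.
Proof.
  intros Hg Hh t. destruct (Hg t), (Hh t). split.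
  - apply (continuous_minus (V := R_NormedModule)
      (fun t => Re (g t) * Re (h t)) (fun t => Im (g t) * Im (h t)));
      now apply (continuous_mult (K := R_AbsRing)).
  - apply (continuous_plus (V := R_NormedModule)
      (fun t => Re (g t) * Im (h t)) (fun t => Im (g t) * Re (h t)));
      now apply (continuous_mult (K := R_AbsRing)).
Qed.

Lemma Ccont_pow (g : R -> C) (n : nat) : Ccont g -> Ccont (fun t => g t ^ n)%C.
Proof.
  intros Hg. induction n as [|n IH]; [exact (Ccont_const (RtoC 1))|].
  now apply (Ccont_mult g (fun t => g t ^ n)%C).
Qed.

Lemma ex_RInt_cont (h : R -> R) (a b : R) : (forall t, continuous h t) -> ex_RInt h a b.
Proof.
  intros Hh. apply (ex_RInt_continuous (V := R_CompleteNormedModule)). intros; apply Hh.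
Qed.

Lemma mean_ext (g h : R -> C) : (forall t, g t = h t) -> mean g = mean h.
Proof.
  intros H. unfold mean. f_equal; f_equal; apply RInt_ext; intros; now rewrite H.
Qed.

Lemma mean_plus (g h : R -> C) : Ccont g -> Ccont h ->
  mean (fun t => g t + h t)%C = (mean g + mean h)%C.
Proof.
  intros Hg Hh. unfold mean, Cplus; simpl. unfold Rdiv.
  rewrite <- !Rmult_plus_distr_r. f_equal; f_equal;
    apply (RInt_plus (V := R_CompleteNormedModule)
      (fun t => _ (g t)) (fun t => _ (h t))); apply ex_RInt_cont; intros t;
    apply Hg || apply Hh.
Qed.

Lemma mean_scal (c : C) (g : R -> C) : Ccont g ->
  mean (fun t => c * g t)%C = (c * mean g)%C.
Proof.
  intros Hg. pose proof PI_RGT_0 as HPI.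
  assert (H1 : ex_RInt (fun t => Re (g t)) (- PI) PI) by (apply ex_RInt_cont; apply Hg).
  assert (H2 : ex_RInt (fun t => Im (g t)) (- PI) PI) by (apply ex_RInt_cont; apply Hg).
  apply (RInt_correct (V := R_CompleteNormedModule)) in H1, H2.
  unfold mean. set (x := RInt (fun t => Re (g t)) (- PI) PI) in *.
  set (y := RInt (fun t => Im (g t)) (- PI) PI) in *.
  unfold Cmult; simpl. f_equal.
  - rewrite (is_RInt_unique (V := R_CompleteNormedModule) _ _ _
      (minus (scal (fst c) x) (scal (snd c) y))).
    + unfold minus, plus, opp, scal; simpl; unfold mult; simpl. field. lra.
    + apply (is_RInt_minus (V := R_NormedModule) (fun t => scal (fst c) (Re (g t)))
        (fun t => scal (snd c) (Im (g t)))); now apply (is_RInt_scal (V := R_NormedModule)).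
  - rewrite (is_RInt_unique (V := R_CompleteNormedModule) _ _ _
      (plus (scal (fst c) y) (scal (snd c) x))).
    + unfold minus, plus, opp, scal; simpl; unfold mult; simpl. field. lra.
    + apply (is_RInt_plus (V := R_NormedModule) (fun t => scal (fst c) (Im (g t)))
        (fun t => scal (snd c) (Re (g t)))); now apply (is_RInt_scal (V := R_NormedModule)).
Qed.

Lemma mean_Re (g : R -> C) : Re (mean g) = RInt (fun t => Re (g t)) (- PI) PI / (2 * PI).
Proof. reflexivity. Qed.

(* Testing against the constant [conj (mean g)] reduces the bound to the real
   integral of [Re (conj (mean g) * g)]. *)
Lemma mean_bound (g : R -> C) (B : R) : Ccont g ->
  (forall t, - PI <= t <= PI -> Cmod (g t) <= B) -> Cmod (mean g) <= B.
Proof.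
  intros Hg HB. pose proof PI_RGT_0 as HPI. set (m := mean g).
  destruct (Req_dec (Cmod m) 0) as [H0|H0].
  { rewrite H0. eapply Rle_trans; [apply Cmod_ge_0|apply (HB 0); lra]. }
  assert (Hm : 0 < Cmod m) by (pose proof (Cmod_ge_0 m); lra).
  assert (Hc : Ccont (fun t => Cconj m * g t)%C) by (apply Ccont_mult; [apply Ccont_const|auto]).
  assert (E : Re (mean (fun t => Cconj m * g t)%C) = Cmod m ^ 2).
  { rewrite mean_scal by auto. fold m. rewrite Cmod2_alt.
    destruct m; unfold Re, Im; simpl; ring. }
  rewrite mean_Re in E.
  assert (H : RInt (fun t => Re (Cconj m * g t)%C) (- PI) PI <= (PI - - PI) * (Cmod m * B)).
  { rewrite <- (RInt_const (V := R_CompleteNormedModule) (- PI) PI (Cmod m * B) :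
      RInt (fun _ => Cmod m * B) (- PI) PI = (PI - - PI) * (Cmod m * B)).
    apply RInt_le; [lra|apply ex_RInt_cont; apply Hc|apply ex_RInt_cont; intros; apply continuous_const|].
    intros t Ht. eapply Rle_trans; [apply Rle_abs|]. eapply Rle_trans; [apply re_le_Cmod|].
    rewrite Cmod_mult, Cmod_conj. apply Rmult_le_compat_l; [lra|]. apply HB; lra. }
  apply Rmult_le_reg_l with (Cmod m); auto.
  replace (Cmod m * Cmod m) with (Cmod m ^ 2) by ring. rewrite <- E.
  apply Rmult_le_reg_r with (2 * PI); [lra|].
  unfold Rdiv. rewrite Rmult_assoc, Rinv_l, Rmult_1_r by lra. lra.
Qed.

Lemma Ccont_bounded (g : R -> C) : Ccont g ->
  exists B, forall t, - PI <= t <= PI -> Cmod (g t) <= B.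
Proof.
  intros Hg.
  destruct (bounded_continuity (V := R_NormedModule) (fun t => Re (g t)) (- PI) PI) as [M1 H1].
  { intros; apply Hg. }
  destruct (bounded_continuity (V := R_NormedModule) (fun t => Im (g t)) (- PI) PI) as [M2 H2].
  { intros; apply Hg. }
  exists (sqrt 2 * Rmax M1 M2). intros t Ht.
  eapply Rle_trans; [apply Cmod_2Rmax|]. apply Rmult_le_compat_l; [apply sqrt_pos|].
  apply Rmax_le_compat; left; [now apply H1|now apply H2].
Qed.

(** * Expansion of the Cauchy kernel in powers of the inner point *)

Definition kernel (w : C) (r t : R) : C :=
  (RtoC r * cis t / (RtoC r * cis t - w))%C.

(** The reciprocal of [RtoC r * cis t], in a closed form whose modulus, powers and continuity are
    immediate. *)
Definition zinv (r t : R) : C := (RtoC (/ r) * cis (- t))%C.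

Lemma zinv_l (r t : R) : r <> 0 -> (zinv r t * (RtoC r * cis t))%C = RtoC 1.
Proof.
  intros Hr. unfold zinv.
  replace (RtoC (/ r) * cis (- t) * (RtoC r * cis t))%C
    with (RtoC (/ r * r) * (cis t * Cconj (cis t)))%C.
  - rewrite cis_conj, Rinv_l by auto. ring.
  - rewrite RtoC_mult. unfold cis, Cconj; simpl fst; simpl snd.
    rewrite cos_neg, sin_neg. ring.
Qed.

Lemma Cmod_zinv (r t : R) : 0 < r -> Cmod (zinv r t) = / r.
Proof.
  intros Hr. unfold zinv. apply Cmod_Rmult_cis. left. now apply Rinv_0_lt_compat.
Qed.

Lemma Ccont_zinv (r : R) : Ccont (zinv r).
Proof.
  intros t. unfold zinv, cis, Re, Im; simpl.
  split; apply (ex_derive_continuous (V := R_NormedModule)); auto_derive; auto.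
Qed.

Lemma Ccont_kernel (f f' : C -> C) (w : C) (r s : R) :
  (forall z, strict_deriv f z (f' z)) -> Cmod w < r ->
  Ccont (fun t => kernel w r t * f (w + RtoC s * (RtoC r * cis t - w)))%C.
Proof.
  intros Hf Hw t. split.
  - apply (continuous_G f f' Hf w r Hw s t).
  - apply (continuous_ext (fun t => Re (kernel w r t *
             (- Ci * f (w + RtoC s * (RtoC r * cis t - w))))%C)).
    { intros x. rewrite Im_Re_Ci. f_equal. ring. }
    apply (continuous_G (fun z => - Ci * f z)%C (fun z => - Ci * f' z)%C); auto.
    intros z. now apply strict_deriv_scal.
Qed.

(** Compares the two ends of the homotopy. This is Cauchy's formula up to the mean of the kernel,
    which [mean_kernel] evaluates. *)
Lemma mean_kernel_const (f f' : C -> C) (w : C) (r : R) :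
  (forall z, strict_deriv f z (f' z)) -> Cmod w < r ->
  mean (fun t => kernel w r t * f (RtoC r * cis t))%C = (f w * mean (kernel w r))%C.
Proof.
  intros Hf Hw.
  assert (Hk : Ccont (kernel w r)).
  { pose proof (Ccont_kernel (fun _ => RtoC 1) (fun _ => RtoC 0) w r 0) as H.
    refine (Ccont_ext _ _ _ (H _ Hw)); [intros t; ring|].
    intros z. apply strict_deriv_const. }
  assert (HG : forall h h' : C -> C, (forall z, strict_deriv h z (h' z)) ->
    RInt (fun t => Re (kernel w r t * h (RtoC r * cis t))%C) (- PI) PI
    = RInt (fun t => Re (kernel w r t * h w)%C) (- PI) PI).
  { intros h h' Hh. pose proof (RInt_G_const h h' Hh w r Hw) as H.
    rewrite (RInt_ext (fun t => Re (kernel w r t * h w)%C) (fun t => Re (RtoC r * cis t / (RtoC r * cis t - w)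
      * h (w + RtoC 0 * (RtoC r * cis t - w)))%C)).
    - rewrite <- H. apply RInt_ext. intros x _. unfold kernel. do 3 f_equal. ring.
    - intros x _. unfold kernel. do 3 f_equal. ring. }
  rewrite <- mean_scal by auto.
  unfold mean. f_equal; f_equal.
  - rewrite (HG f f') by auto. apply RInt_ext. intros x _. f_equal. ring.
  - rewrite (RInt_ext _ (fun t => Re (kernel w r t * (- Ci * f (RtoC r * cis t)))%C)).
    + rewrite (HG (fun z => - Ci * f z)%C (fun z => - Ci * f' z)%C)
        by (intros; now apply strict_deriv_scal).
      apply RInt_ext. intros x _. rewrite Im_Re_Ci. f_equal. ring.
    + intros x _. rewrite Im_Re_Ci. f_equal. ring.
Qed.

(** Iterates the fixed-point equation [kernel = 1 + w * zinv * kernel]; the exact remainder again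
    contains the kernel, so it is bounded along with it. *)
Lemma kernel_expansion (w : C) (r t : R) (N : nat) : Cmod w < r ->
  kernel w r t = (psum (fun n => zinv r t ^ n)%C w N
                  + (w * zinv r t) ^ S N * kernel w r t)%C.
Proof.
  intros Hw.
  assert (Hr : 0 < r) by (pose proof (Cmod_ge_0 w); lra).
  assert (Hk : kernel w r t = (1 + w * zinv r t * kernel w r t)%C).
  { pose proof (zeta_neq w r Hw t) as Hne.
    assert (Hz : (zinv r t * (RtoC r * cis t))%C = 1%C) by (apply zinv_l; lra). unfold kernel.
    set (z := (RtoC r * cis t)%C) in *.
    replace (w * zinv r t * (z / (z - w)))%C with (w * (zinv r t * z) / (z - w))%C
      by (unfold Cdiv; ring).
    rewrite Hz. field. exact Hne. }
  induction N as [|N IH].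
  - rewrite psum_O. rewrite Hk at 1. simpl. ring.
  - rewrite psum_S. rewrite IH at 1. rewrite Hk at 1.
    rewrite (Cpow_S _ (S N)), !Cpow_mult_l. ring.
Qed.

(** The kernel expansion integrated against [phi]: if [B] bounds [kernel * phi], the remainder is at
    most [B * (Cmod w / r) ^ S N]. It serves for [f] on the circle and for [phi = 1]. *)
Lemma mean_kernel_psums (phi : R -> C) (w : C) (r : R) :
  Cmod w < r -> Ccont phi -> Ccont (fun t => kernel w r t * phi t)%C ->
  psums (fun n => mean (fun t => phi t * zinv r t ^ n)%C) w
    (mean (fun t => kernel w r t * phi t)%C).
Proof.
  intros Hw Hphi Hkphi.
  assert (Hr : 0 < r) by (pose proof (Cmod_ge_0 w); lra).
  destruct (Ccont_bounded _ Hkphi) as [B HB].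
  assert (HPI := PI_RGT_0).
  assert (HB0 : 0 <= B) by (eapply Rle_trans; [apply Cmod_ge_0|apply (HB 0); lra]).
  assert (Hq : 0 <= Cmod w / r < 1).
  { split; [apply Rdiv_le_0_compat; auto using Cmod_ge_0|].
    apply Rmult_lt_reg_r with r; auto. field_simplify; lra. }
  (* Continuity is proved together with the identity because additivity of [mean] needs it at each
     step. *)
  assert (Hs : forall N, Ccont (fun t => phi t * psum (fun n => zinv r t ^ n)%C w N)%C
     /\ psum (fun n => mean (fun t => phi t * zinv r t ^ n)%C) w N
        = mean (fun t => phi t * psum (fun n => zinv r t ^ n)%C w N)%C).
  { assert (Hn : forall n, Ccont (fun t => phi t * zinv r t ^ n)%C).
    { intros n. apply Ccont_mult; auto. apply Ccont_pow, Ccont_zinv. }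
    induction N as [|N [IH1 IH2]].
    - split.
      + apply (Ccont_ext (fun t => phi t * zinv r t ^ 0)%C); auto.
        intros t. now rewrite psum_O.
      + rewrite psum_O. apply mean_ext. intros t. now rewrite psum_O.
    - assert (E : forall t, (phi t * psum (fun n => zinv r t ^ n) w (S N)
        = phi t * psum (fun n => zinv r t ^ n) w N + w ^ S N * (phi t * zinv r t ^ S N))%C)
        by (intros t; rewrite psum_S; ring).
      assert (Hc : Ccont (fun t => w ^ S N * (phi t * zinv r t ^ S N))%C)
        by (apply Ccont_mult; [apply Ccont_const|apply Hn]).
      split.
      + apply (Ccont_ext _ _ (fun t => eq_sym (E t))). now apply Ccont_plus.
      + rewrite psum_S, IH2. rewrite (mean_ext _ _ E), mean_plus by auto.
        rewrite mean_scal by auto. ring. }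
  unfold psums.
  apply is_lim_seq_0_le with (fun N => B * (Cmod w / r) ^ S N).
  - intros N. split; [apply Cmod_ge_0|]. destruct (Hs N) as [H1 ->].
    set (R1 := fun t => ((w * zinv r t) ^ S N * (kernel w r t * phi t))%C).
    assert (HR : Ccont R1).
    { unfold R1. apply Ccont_mult; auto. apply Ccont_pow, Ccont_mult;
      [apply Ccont_const|apply Ccont_zinv]. }
    rewrite (mean_ext (fun t => kernel w r t * phi t)%C
      (fun t => phi t * psum (fun n => zinv r t ^ n) w N + R1 t)%C).
    + rewrite mean_plus by auto.
      match goal with |- Cmod (?x + ?y - ?x) <= _ =>
        replace (x + y - x)%C with y by ring end.
      apply mean_bound; auto. intros t Ht. unfold R1.
      rewrite Cmod_mult, Cmod_pow, Cmod_mult, Cmod_zinv by auto.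
      rewrite Rmult_comm. apply Rmult_le_compat_r; auto. apply pow_le, Hq.
    + intros t. unfold R1. rewrite (kernel_expansion w r t N Hw) at 1. ring.
  - replace (Finite 0) with (Rbar_mult B 0) by (simpl; f_equal; ring).
    apply is_lim_seq_scal_l, (is_lim_seq_incr_1 (fun n => (Cmod w / r) ^ n)), is_lim_seq_geom.
    rewrite Rabs_pos_eq; lra.
Qed.

Lemma mean_const (c : C) : mean (fun _ => c) = c.
Proof.
  unfold mean. rewrite !RInt_const. pose proof PI_RGT_0.
  destruct c as [x y]; unfold Re, Im, scal; simpl; unfold mult; simpl.
  f_equal; field; lra.
Qed.

Lemma mean_zinv_pow (r : R) (n : nat) : mean (fun t => zinv r t ^ S n)%C = RtoC 0.
Proof.
  assert (E : forall t, (zinv r t ^ S n)%C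
     = ((/ r) ^ S n * cos (INR (S n) * t), - ((/ r) ^ S n * sin (INR (S n) * t)))).
  { intros t. unfold zinv. rewrite Cpow_mult_l, cis_pow, <- RtoC_pow.
    replace (INR (S n) * - t) with (- (INR (S n) * t)) by ring.
    unfold cis. rewrite cos_neg, sin_neg. unfold Cmult, RtoC; simpl. f_equal; ring. }
  pose proof PI_RGT_0. unfold mean, RtoC. f_equal.
  - rewrite (is_RInt_unique (V := R_CompleteNormedModule) _ _ _ 0); [apply Rdiv_0_l|].
    apply (is_RInt_ext (V := R_NormedModule) (fun t => (/ r) ^ S n * cos (INR (S n) * t) + 0 * sin (INR (S n) * t)));
      [|apply is_RInt_trig; lia].
    intros t _. rewrite E. unfold Re, fst. eqR. ring.
  - rewrite (is_RInt_unique (V := R_CompleteNormedModule) _ _ _ 0); [apply Rdiv_0_l|].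
    apply (is_RInt_ext (V := R_NormedModule) (fun t => 0 * cos (INR (S n) * t) + - (/ r) ^ S n * sin (INR (S n) * t)));
      [|apply is_RInt_trig; lia].
    intros t _. rewrite E. unfold Im, snd. eqR. ring.
Qed.

(** With [phi = 1] every coefficient of positive degree is the mean of a nonzero frequency, so the
    series reduces to its constant term. *)
Lemma mean_kernel (w : C) (r : R) : Cmod w < r -> mean (kernel w r) = RtoC 1.
Proof.
  intros Hw.
  assert (H1 : Ccont (fun t => kernel w r t * 1)%C).
  { apply (Ccont_kernel (fun _ => RtoC 1) (fun _ => RtoC 0) w r 0); auto.
    intros z. apply strict_deriv_const. }
  pose proof (mean_kernel_psums (fun _ => RtoC 1) w r Hw (Ccont_const 1) H1) as H.
  cbv beta in H.
  rewrite (mean_ext (fun t => kernel w r t * 1)%C (kernel w r)) in H by (intros; ring).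
  apply (psums_unique _ w _ _ H).
  assert (Hz : forall N, psum (fun n => mean (fun t => 1 * zinv r t ^ n)%C) w N = RtoC 1).
  { induction N as [|N IH].
    - rewrite psum_O. rewrite (mean_ext _ (fun _ => RtoC 1)) by (intros; simpl; ring).
      apply mean_const.
    - rewrite psum_S, IH. rewrite (mean_ext _ (fun t => zinv r t ^ S N)%C) by (intros; ring).
      rewrite mean_zinv_pow. ring. }
  apply is_lim_seq_ext with (fun _ => 0); [|apply is_lim_seq_const].
  intros N. rewrite Hz. replace (1 - 1)%C with (RtoC 0) by ring. now rewrite Cmod_0.
Qed.

Lemma holomorphic_power_series (f f' : C -> C) (r : R) :
  (forall z, strict_deriv f z (f' z)) ->
  exists c, forall w, Cmod w < r -> psums c w (f w).
Proof.
  intros Hf. exists (fun n => mean (fun t => f (RtoC r * cis t) * zinv r t ^ n)%C).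
  intros w Hw.
  replace (f w) with (mean (fun t => kernel w r t * f (RtoC r * cis t))%C).
  - apply mean_kernel_psums; auto.
    + intros t.
      (* Continuity of [f] on the circle is read off the homotopy with centre [0] at [s = 1]. *)
      assert (E : forall t, (0 + RtoC 1 * (RtoC r * cis t - 0))%C = (RtoC r * cis t)%C)
        by (intros; ring).
      assert (Hw0 : Cmod 0 < r) by (rewrite Cmod_0; pose proof (Cmod_ge_0 w); lra).
      split; apply (ex_derive_continuous (V := R_NormedModule)).
      * eexists. eapply is_derive_ext; [|apply (is_derive_f_zeta f f' Hf 0%C r Hw0 1 1)].
        intros x. cbv beta. rewrite E. f_equal. ring.
      * eexists. eapply is_derive_ext; [|apply (is_derive_f_zeta f f' Hf 0%C r Hw0 (- Ci)%C 1)].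
        intros x. cbv beta. rewrite E. now rewrite Im_Re_Ci.
    + refine (Ccont_ext _ _ _ (Ccont_kernel f f' w r 1 Hf Hw)).
      intros t. do 2 f_equal. ring.
  - rewrite (mean_kernel_const f f') by auto. rewrite mean_kernel by auto. ring.
Qed.

(** The coefficients given by Cauchy's formula depend a priori on the radius, here [Cmod w + 1];
    uniqueness on a common smaller disc identifies them with [a], whatever [w] is. *)
Lemma entire_taylor_psums (f : C -> C) (z0 : C) (a : nat -> C) :
  entire f -> taylor_coeffs f z0 a -> forall w, psums a w (f (z0 + w)%C).
Proof.
  intros Hf (r & Hr & Ha) w.
  destruct (entire_strict_deriv f Hf) as [f' Hf'].
  destruct (holomorphic_power_series (fun w => f (z0 + w)%C) (fun w => f' (z0 + w)%C)
    (Cmod w + 1)) as [c Hc].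
  { intros z eps Heps. destruct (Hf' (z0 + z)%C eps Heps) as (d & Hd & H).
    exists d. split; auto. intros u v Hu Hv.
    replace (u - v)%C with ((z0 + u) - (z0 + v))%C by ring. apply H.
    - now replace (z0 + u - (z0 + z))%C with (u - z)%C by ring.
    - now replace (z0 + v - (z0 + z))%C with (v - z)%C by ring. }
  pose proof (Cmod_ge_0 w).
  apply psums_ext with c (f (z0 + w)%C); auto; [|apply Hc; lra].
  intros k. apply (psums_coeff_unique c a (Rmin r (Cmod w + 1)) (fun w => f (z0 + w)%C)).
  - apply Rmin_glb_lt; lra.
  - intros u Hu. apply Hc. eapply Rlt_le_trans; [exact Hu|apply Rmin_r].
  - intros u Hu. apply psums_is_pseries, Ha. eapply Rlt_le_trans; [exact Hu|apply Rmin_l].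
Qed.

(** * The complex exponential series *)

Lemma CV_radius_entire (a : nat -> R) :
  (forall x, 0 <= x -> exists M, forall n, Rabs (a n * x ^ n) <= M) ->
  CV_radius a = p_infty.
Proof.
  intros H. destruct (CV_radius_bounded a) as [Hub _].
  destruct (CV_radius a) as [r| |]; auto.
  - exfalso. specialize (Hub (Rabs r + 1) (H (Rabs r + 1) ltac:(pose proof (Rabs_pos r); lra))).
    simpl in Hub. pose proof (Rle_abs r). lra.
  - exfalso. apply (Hub 0 (H 0 ltac:(lra))).
Qed.

Lemma pow_fact_bounded (x : R) (n : nat) : 0 <= x -> x ^ n / INR (fact n) <= exp x.
Proof.
  intros Hx. eapply Rle_trans; [|apply (exp_ge_taylor x n Hx)].
  assert (Hp : forall k, 0 <= x ^ k / INR (fact k)).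
  { intros k. apply Rdiv_le_0_compat; [now apply pow_le|apply INR_fact_lt_0]. }
  destruct n as [|n]; [simpl; lra|].
  rewrite tech5. pose proof (cond_pos_sum _ n Hp). lra.
Qed.

Section ComplexExponential.

Variable z : C.

(** [p] and [q] are the coefficients of the real and imaginary parts of [exp (s z)] as power series
    in the real variable [s]; comparison with [Cexp] then becomes a linear differential system. *)
Let p (n : nat) : R := Re (z ^ n) / INR (fact n).
Let q (n : nat) : R := Im (z ^ n) / INR (fact n).

Lemma CV_radius_fact (c : nat -> R) : (forall n, Rabs (c n) <= Cmod z ^ n) ->
  CV_radius (fun n => c n / INR (fact n)) = p_infty.
Proof.
  intros Hc. apply CV_radius_entire. intros x Hx. exists (exp (Cmod z * x)). intros n.
  eapply Rle_trans; [|apply (pow_fact_bounded (Cmod z * x) n)].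
  - pose proof (INR_fact_lt_0 n). unfold Rdiv.
    rewrite !Rabs_mult, Rabs_inv, (Rabs_pos_eq (x ^ n)), (Rabs_pos_eq (INR _)) by
      (try apply pow_le; lra).
    rewrite Rpow_mult_distr.
    replace (Rabs (c n) * / INR (fact n) * x ^ n)
      with (Rabs (c n) * (x ^ n * / INR (fact n))) by ring.
    rewrite (Rmult_assoc (Cmod z ^ n)). apply Rmult_le_compat_r; auto.
    apply Rmult_le_pos; [now apply pow_le|]. left. now apply Rinv_0_lt_compat.
  - apply Rmult_le_pos; auto. apply Cmod_ge_0.
Qed.

Lemma im_le_Cmod (c : C) : Rabs (Im c) <= Cmod c.
Proof. eapply Rle_trans; [|apply Rmax_Cmod]. apply Rmax_r. Qed.

Lemma CV_p : CV_radius p = p_infty.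
Proof.
  apply (CV_radius_fact (fun n => Re (z ^ n))). intros n. rewrite <- Cmod_pow.
  apply re_le_Cmod.
Qed.

Lemma CV_q : CV_radius q = p_infty.
Proof.
  apply (CV_radius_fact (fun n => Im (z ^ n))). intros n. rewrite <- Cmod_pow.
  apply im_le_Cmod.
Qed.

Lemma is_pseries_p (s : R) : is_pseries p s (PSeries p s).
Proof. apply PSeries_correct, CV_radius_inside. rewrite CV_p. exact I. Qed.

Lemma is_pseries_q (s : R) : is_pseries q s (PSeries q s).
Proof. apply PSeries_correct, CV_radius_inside. rewrite CV_q. exact I. Qed.

Lemma is_derive_p (s : R) :
  is_derive (PSeries p) s (Re z * PSeries p s - Im z * PSeries q s).
Proof.
  replace (Re z * PSeries p s - Im z * PSeries q s) with (PSeries (PS_derive p) s).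
  { apply is_derive_PSeries. rewrite CV_p. exact I. }
  apply is_pseries_unique.
  apply (is_pseries_ext (PS_minus (PS_scal (Re z) p) (PS_scal (Im z) q))).
  - intros n. change (Re z * p n + - (Im z * q n) = INR (S n) * p (S n)). unfold p, q.
    rewrite fact_simpl, mult_INR, Cpow_S. pose proof (INR_fact_lt_0 n).
    pose proof (lt_0_INR (S n) ltac:(lia)).
    change (Re (z * z ^ n)) with (Re z * Re (z ^ n) - Im z * Im (z ^ n)).
    field. split; lra.
  - apply (is_pseries_minus (V := R_NormedModule));
      apply (is_pseries_scal (V := R_NormedModule)); try apply Rmult_comm;
      [apply is_pseries_p|apply is_pseries_q].
Qed.

Lemma is_derive_q (s : R) :
  is_derive (PSeries q) s (Re z * PSeries q s + Im z * PSeries p s).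
Proof.
  replace (Re z * PSeries q s + Im z * PSeries p s) with (PSeries (PS_derive q) s).
  { apply is_derive_PSeries. rewrite CV_q. exact I. }
  apply is_pseries_unique.
  apply (is_pseries_ext (PS_plus (PS_scal (Re z) q) (PS_scal (Im z) p))).
  - intros n. change (Re z * q n + Im z * p n = INR (S n) * q (S n)). unfold p, q.
    rewrite fact_simpl, mult_INR, Cpow_S. pose proof (INR_fact_lt_0 n).
    pose proof (lt_0_INR (S n) ltac:(lia)).
    change (Im (z * z ^ n)) with (Re z * Im (z ^ n) + Im z * Re (z ^ n)).
    field. split; lra.
  - apply (is_pseries_plus (V := R_NormedModule));
      apply (is_pseries_scal (V := R_NormedModule)); try apply Rmult_comm;
      [apply is_pseries_q|apply is_pseries_p].
Qed.

(* [e^(-s z) * sum (s z)^n / n!] has zero derivative in [s]. *)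
Lemma PSeries_exp :
  PSeries p 1 = exp (Re z) * cos (Im z) /\ PSeries q 1 = exp (Re z) * sin (Im z).
Proof.
  set (P := PSeries p). set (Q := PSeries q).
  set (x := Re z). set (y := Im z).
  assert (HP : forall s, is_derive P s (x * P s - y * Q s)) by apply is_derive_p.
  assert (HQ : forall s, is_derive Q s (x * Q s + y * P s)) by apply is_derive_q.
  assert (DP : forall s, Derive (fun t : R => P t) s = x * P s - y * Q s)
    by (intros s; apply is_derive_unique, HP).
  assert (DQ : forall s, Derive (fun t : R => Q t) s = x * Q s + y * P s)
    by (intros s; apply is_derive_unique, HQ).
  assert (P0 : P 0 = 1).
  { unfold P. rewrite PSeries_0. unfold p. simpl. unfold Re; simpl. field. }
  assert (Q0 : Q 0 = 0).
  { unfold Q. rewrite PSeries_0. unfold q. simpl. unfold Im; simpl. field. }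
  set (h1 := fun s => exp (- s * x) * (P s * cos (s * y) + Q s * sin (s * y))).
  set (h2 := fun s => exp (- s * x) * (Q s * cos (s * y) - P s * sin (s * y))).
  assert (H1 : h1 1 = h1 0).
  { apply is_derive_0_const. intros s. unfold h1.
    auto_derive.
    - repeat split; eexists; [apply HP|apply HQ].
    - rewrite DP, DQ. ring. }
  assert (H2 : h2 1 = h2 0).
  { apply is_derive_0_const. intros s. unfold h2.
    auto_derive.
    - repeat split; eexists; [apply HQ|apply HP].
    - rewrite DP, DQ. ring. }
  unfold h1, h2 in *. rewrite P0, Q0 in *.
  rewrite !Rmult_0_l, !Rmult_1_l, Ropp_0, Rmult_0_l, exp_0, cos_0, sin_0 in *.
  replace (- (1) * x) with (- x) in * by ring. rewrite exp_Ropp in *.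
  pose proof (exp_pos x) as Hex.
  assert (E1 : P 1 * cos y + Q 1 * sin y = exp x).
  { apply Rmult_eq_reg_l with (/ exp x); [|apply Rinv_neq_0_compat; lra].
    rewrite Rinv_l by lra. rewrite H1. ring. }
  assert (E2 : Q 1 * cos y - P 1 * sin y = 0).
  { apply Rmult_eq_reg_l with (/ exp x); [|apply Rinv_neq_0_compat; lra].
    rewrite H2. ring. }
  pose proof (sin2_cos2 y) as Hsc. unfold Rsqr in Hsc.
  split.
  - replace (P 1) with (P 1 * (sin y * sin y + cos y * cos y)) by (rewrite Hsc; ring).
    replace (P 1 * (sin y * sin y + cos y * cos y))
      with ((P 1 * cos y + Q 1 * sin y) * cos y - (Q 1 * cos y - P 1 * sin y) * sin y) by ring.
    rewrite E1, E2. ring.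
  - replace (Q 1) with (Q 1 * (sin y * sin y + cos y * cos y)) by (rewrite Hsc; ring).
    replace (Q 1 * (sin y * sin y + cos y * cos y))
      with ((P 1 * cos y + Q 1 * sin y) * sin y + (Q 1 * cos y - P 1 * sin y) * cos y) by ring.
    rewrite E1, E2. ring.
Qed.

Lemma Cexp_psums : psums (fun n => RtoC (/ INR (fact n))) z (Cexp z).
Proof.
  destruct PSeries_exp as [HP HQ].
  assert (Hp := is_pseries_p 1). assert (Hq := is_pseries_q 1).
  rewrite HP in Hp. rewrite HQ in Hq.
  assert (E : forall N, psum (fun n => RtoC (/ INR (fact n))) z N
    = (sum_n (fun k => scal (pow_n (K := R_AbsRing) 1 k) (p k)) N,
       sum_n (fun k => scal (pow_n (K := R_AbsRing) 1 k) (q k)) N)).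
  { assert (Et : forall k, (RtoC (/ INR (fact k)) * z ^ k)%C
       = (scal (pow_n (K := R_AbsRing) 1 k) (p k), scal (pow_n (K := R_AbsRing) 1 k) (q k))).
    { intros k. rewrite pow_n_pow, pow1. unfold p, q, scal; simpl; unfold mult; simpl.
      unfold Cmult, RtoC, Re, Im; simpl. unfold Rdiv. f_equal; ring. }
    induction N as [|N IH].
    - rewrite psum_O, !sum_O, <- Et. simpl. ring.
    - rewrite psum_S, !sum_Sn, IH, Et. reflexivity. }
  unfold psums.
  set (sp := fun N => sum_n (fun k => scal (pow_n (K := R_AbsRing) 1 k) (p k)) N) in *.
  set (sq := fun N => sum_n (fun k => scal (pow_n (K := R_AbsRing) 1 k) (q k)) N) in *.
  assert (E' : forall N, psum (fun n => RtoC (/ INR (fact n))) z N = (sp N, sq N)) by exact E.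
  apply (is_lim_seq_0_le _ (fun N => Rabs (exp (Re z) * cos (Im z) - sp N)
                                   + Rabs (exp (Re z) * sin (Im z) - sq N))).
  - intros N. split; [apply Cmod_ge_0|]. rewrite E'.
    unfold Cexp. set (u := exp (Re z) * cos (Im z) - sp N).
    set (v := exp (Re z) * sin (Im z) - sq N).
    replace (_ - _)%C with (RtoC u + RtoC v * Ci)%C.
    + eapply Rle_trans; [apply Cmod_triangle|].
      rewrite Cmod_mult, Cmod_Ci, !Cmod_R. lra.
    + unfold u, v, Cminus, Cplus, Copp, RtoC, Ci, Cmult; simpl. f_equal; ring.
  - assert (Hlim : forall (s : nat -> R) (l : R), is_lim_seq s l ->
      is_lim_seq (fun N => Rabs (l - s N)) 0).
    { intros s l Hs. replace (Finite 0) with (Rbar_abs (l - l))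
        by (simpl; f_equal; rewrite Rminus_diag; apply Rabs_R0).
      apply (is_lim_seq_abs _ (l - l)). apply is_lim_seq_minus'; auto. apply is_lim_seq_const. }
    replace (Finite 0) with (Finite (0 + 0)) by (f_equal; ring).
    apply is_lim_seq_plus'; apply Hlim; [exact Hp|exact Hq].
Qed.

End ComplexExponential.

(** * Charlier polynomials *)

Section Charlier.

Variable lambda : R.
Hypothesis Hl : 0 < lambda.

Let w : nat -> R := poisson_weight lambda.

Lemma poisson_weight_pos (n : nat) : 0 < w n.
Proof.
  apply Rmult_lt_0_compat; [apply exp_pos|].
  apply Rdiv_lt_0_compat; [now apply pow_lt|apply INR_fact_lt_0].
Qed.

Lemma poisson_weight_S (n : nat) : w (S n) * (INR (S n) / lambda) = w n.
Proof.
  unfold w, poisson_weight. rewrite fact_simpl, mult_INR. simpl (lambda ^ S n).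
  pose proof (INR_fact_lt_0 n). pose proof (lt_0_INR (S n) ltac:(lia)).
  field. repeat split; lra.
Qed.

(** This is [(-1) ^ k] times the usual Charlier polynomial. The recursion encodes multiplication of
    the generating function by [z - 1]: multiplying by [z] shifts the coefficients, and
    [w (n - 1) = w n * (n / lambda)]. At [n = 0] the factor [INR n] vanishes, which makes the value
    [pred 0 = 0] harmless. *)
Fixpoint charlier (k n : nat) : R :=
  match k with
  | 0%nat => 1
  | S k => INR n / lambda * charlier k (pred n) - charlier k n
  end.

Lemma Cexp_shift_psums (z : C) :
  psums (fun n => RtoC (w n)) z (Cexp (RtoC lambda * (z - 1))).
Proof.
  assert (H := psums_scal (RtoC (exp (- lambda))) _ _ _ (Cexp_psums (RtoC lambda * z))).
  unfold psums in *. revert H.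
  replace (RtoC (exp (- lambda)) * Cexp (RtoC lambda * z))%C
    with (Cexp (RtoC lambda * (z - 1))).
  - apply is_lim_seq_ext. intros N. do 2 f_equal.
    induction N as [|N IH].
    + rewrite !psum_O. unfold w, poisson_weight. rewrite <- RtoC_mult. f_equal. simpl. field.
    + rewrite !psum_S, IH. f_equal. unfold w, poisson_weight, Rdiv.
      rewrite Cpow_mult_l, <- RtoC_pow, !RtoC_mult. ring.
  - destruct z as [x y]. unfold Cexp, RtoC, Cmult, Re, Im; simpl.
    replace (lambda * (x + - (1)) - 0 * (y + - 0)) with (- lambda + (lambda * x - 0 * y)) by ring.
    replace (lambda * (y + - 0) + 0 * (x + - (1))) with (lambda * y + 0 * x) by ring.
    rewrite exp_plus. f_equal; ring.
Qed.

Lemma charlier_psums (k : nat) (z : C) :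
  psums (fun n => RtoC (w n * charlier k n)) z
    (Cexp (RtoC lambda * (z - 1)) * (z - 1) ^ k)%C.
Proof.
  induction k as [|k IH].
  - apply (psums_ext (fun n => RtoC (w n)) _ z (Cexp (RtoC lambda * (z - 1)))%C).
    + intros n. simpl. now rewrite Rmult_1_r.
    + simpl. ring.
    + apply Cexp_shift_psums.
  - refine (psums_ext _ _ _ _ _ _ _ (psums_minus _ _ _ _ _ (psums_shift _ _ _ IH) IH)).
    + intros [|n]; unfold shift; cbn [charlier].
      * rewrite <- RtoC_minus. f_equal. simpl (INR 0). unfold Rdiv. ring.
      * rewrite <- RtoC_minus. f_equal. rewrite <- (poisson_weight_S n). unfold pred. ring.
    + rewrite Cpow_S. ring.
Qed.

(** A class stable under sums, products and shifts that contains the Charlier polynomials, and on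
    which weighted sums converge by comparison with the exponential series; no degrees need
    tracking. *)
Definition exp_bounded (g : nat -> R) : Prop :=
  exists B E, 0 <= B /\ 0 <= E /\ forall n, Rabs (g n) <= B * E ^ n.

(** The creation operator: [charlier (S k)] is [raise (charlier k)] by conversion. [lower] is the
    corresponding annihilation operator. *)
Definition raise (g : nat -> R) (n : nat) : R := INR n / lambda * g (pred n) - g n.
Definition lower (g : nat -> R) (n : nat) : R := g (S n) - g n.

Lemma exp_bounded_mult (g h : nat -> R) :
  exp_bounded g -> exp_bounded h -> exp_bounded (fun n => g n * h n).
Proof.
  intros (B & E & HB & HE & Hg) (B' & E' & HB' & HE' & Hh).
  exists (B * B'), (E * E'). repeat split; try now apply Rmult_le_pos.
  intros n. rewrite Rabs_mult, Rpow_mult_distr.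
  replace (B * B' * (E ^ n * E' ^ n)) with ((B * E ^ n) * (B' * E' ^ n)) by ring.
  apply Rmult_le_compat; auto using Rabs_pos.
Qed.

Lemma exp_bounded_plus (g h : nat -> R) :
  exp_bounded g -> exp_bounded h -> exp_bounded (fun n => g n + h n).
Proof.
  intros (B & E & HB & HE & Hg) (B' & E' & HB' & HE' & Hh).
  exists (B + B'), (E + E'). repeat split; try lra.
  intros n. eapply Rle_trans; [apply Rabs_triang|].
  assert (E ^ n <= (E + E') ^ n) by (apply pow_incr; lra).
  assert (E' ^ n <= (E + E') ^ n) by (apply pow_incr; lra).
  specialize (Hg n). specialize (Hh n).
  assert (B * E ^ n <= B * (E + E') ^ n) by now apply Rmult_le_compat_l.
  assert (B' * E' ^ n <= B' * (E + E') ^ n) by now apply Rmult_le_compat_l. lra.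
Qed.

Lemma exp_bounded_ext (g h : nat -> R) :
  (forall n, g n = h n) -> exp_bounded g -> exp_bounded h.
Proof.
  intros Hgh (B & E & HB & HE & Hg). exists B, E. repeat split; auto.
  intros n. now rewrite <- Hgh.
Qed.

Lemma exp_bounded_const (c : R) : exp_bounded (fun _ => c).
Proof.
  exists (Rabs c), 1. repeat split; try lra; [apply Rabs_pos|].
  intros n. rewrite pow1. lra.
Qed.

Lemma exp_bounded_INR : exp_bounded INR.
Proof.
  exists 1, 2. repeat split; try lra. intros n.
  rewrite Rabs_pos_eq by apply pos_INR. rewrite Rmult_1_l.
  induction n as [|n IH]; [simpl; lra|]. rewrite S_INR. simpl (2 ^ S n).
  assert (1 <= 2 ^ n) by (apply pow_R1_Rle; lra). lra.
Qed.

Lemma exp_bounded_S (g : nat -> R) : exp_bounded g -> exp_bounded (fun n => g (S n)).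
Proof.
  intros (B & E & HB & HE & Hg). exists (B * E), E.
  repeat split; auto; [now apply Rmult_le_pos|].
  intros n. replace (B * E * E ^ n) with (B * E ^ S n) by (simpl; ring). apply Hg.
Qed.

Lemma exp_bounded_pred (g : nat -> R) : exp_bounded g -> exp_bounded (fun n => g (pred n)).
Proof.
  intros (B & E & HB & HE & Hg). exists B, (E + 1). repeat split; try lra.
  intros n. eapply Rle_trans; [apply Hg|]. apply Rmult_le_compat_l; auto.
  apply Rle_trans with ((E + 1) ^ pred n); [apply pow_incr; lra|].
  apply Rle_pow; [lra|lia].
Qed.

Lemma exp_bounded_minus (g h : nat -> R) :
  exp_bounded g -> exp_bounded h -> exp_bounded (fun n => g n - h n).
Proof.
  intros Hg Hh.
  apply (exp_bounded_ext (fun n => g n + (-1) * h n)); [intros; ring|].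
  apply exp_bounded_plus, exp_bounded_mult; auto. apply exp_bounded_const.
Qed.

Lemma exp_bounded_raise (g : nat -> R) : exp_bounded g -> exp_bounded (raise g).
Proof.
  intros Hg. apply (exp_bounded_minus (fun n => INR n / lambda * g (pred n)) g); auto.
  apply (exp_bounded_mult (fun n => INR n / lambda) (fun n => g (pred n)));
    [|now apply exp_bounded_pred].
  apply (exp_bounded_mult INR (fun _ => / lambda)); [apply exp_bounded_INR|].
  apply exp_bounded_const.
Qed.

Lemma exp_bounded_charlier (k : nat) : exp_bounded (charlier k).
Proof.
  induction k as [|k IH]; [apply exp_bounded_const|]. now apply exp_bounded_raise in IH.
Qed.

Lemma ex_series_weight (g : nat -> R) : exp_bounded g -> ex_series (fun n => w n * g n).
Proof.
  intros (B & E & HB & HE & Hg).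
  apply (ex_series_le (V := R_CompleteNormedModule) _
    (fun n => exp (- lambda) * B * (pow_n (K := R_AbsRing) (lambda * E) n * / INR (fact n)))).
  - intros n. change (Rabs (w n * g n) <= exp (- lambda) * B *
      (pow_n (K := R_AbsRing) (lambda * E) n * / INR (fact n))).
    rewrite Rabs_mult, (Rabs_pos_eq (w n)) by (left; apply poisson_weight_pos).
    rewrite pow_n_pow, Rpow_mult_distr.
    replace (exp (- lambda) * B * (lambda ^ n * E ^ n * / INR (fact n)))
      with (w n * (B * E ^ n)) by (unfold w, poisson_weight, Rdiv; ring).
    apply Rmult_le_compat_l; [left; apply poisson_weight_pos|apply Hg].
  - apply (ex_series_scal (V := R_NormedModule)). eexists. apply is_exp_Reals.
Qed.

Definition ip (g h : nat -> R) : R := Series (fun n => w n * (g n * h n)).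

Lemma ip_comm (g h : nat -> R) : ip g h = ip h g.
Proof. apply Series_ext. intros n. ring. Qed.

Lemma ip_ext (g h h' : nat -> R) : (forall n, h n = h' n) -> ip g h = ip g h'.
Proof. intros H. apply Series_ext. intros n. now rewrite H. Qed.

Lemma ip_scal_r (c : R) (g h : nat -> R) : ip g (fun n => c * h n) = c * ip g h.
Proof.
  unfold ip. rewrite <- Series_scal_l. apply Series_ext. intros n. ring.
Qed.

Lemma ip_plus_l (g g' h : nat -> R) :
  exp_bounded g -> exp_bounded g' -> exp_bounded h ->
  ip (fun n => g n + g' n) h = ip g h + ip g' h.
Proof.
  intros Hg Hg' Hh. unfold ip. rewrite <- Series_plus.
  - apply Series_ext. intros n. ring.
  - now apply ex_series_weight, exp_bounded_mult.
  - now apply ex_series_weight, exp_bounded_mult.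
Qed.

(** Summation by parts: the term [n = 0] vanishes and [poisson_weight_S] absorbs the factor
    [n / lambda] when the index is shifted. *)
Lemma ip_raise (g h : nat -> R) :
  exp_bounded g -> exp_bounded h -> ip (raise g) h = ip g (lower h).
Proof.
  intros Hg Hh. unfold ip.
  assert (H1 : ex_series (fun n => w n * (INR n / lambda * g (pred n) * h n))).
  { apply (ex_series_weight (fun n => INR n / lambda * g (pred n) * h n)).
    repeat apply (exp_bounded_mult (fun n => _) (fun n => _)); auto.
    - apply exp_bounded_INR.
    - apply exp_bounded_const.
    - now apply exp_bounded_pred. }
  assert (H2 : ex_series (fun n => w n * (g n * h n)))
    by now apply ex_series_weight, exp_bounded_mult.
  assert (H3 : ex_series (fun n => w n * (g n * h (S n)))).
  { apply (ex_series_weight (fun n => g n * h (S n))), exp_bounded_mult; auto.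
    now apply exp_bounded_S. }
  rewrite (Series_ext _ (fun n => w n * (INR n / lambda * g (pred n) * h n)
    - w n * (g n * h n))) by (intros n; unfold raise; ring).
  rewrite (Series_ext (fun n => w n * (g n * lower h n)) (fun n => w n * (g n * h (S n))
    - w n * (g n * h n))) by (intros n; unfold lower; ring).
  rewrite !Series_minus by auto. f_equal.
  rewrite Series_incr_1 by auto. simpl (INR 0).
  rewrite (Series_ext (fun k => w (S k) * (INR (S k) / lambda * g (pred (S k)) * h (S k)))
    (fun n => w n * (g n * h (S n)))).
  - unfold Rdiv. ring.
  - intros n. rewrite <- (poisson_weight_S n). simpl pred. ring.
Qed.

(** The canonical commutation relation, with constant [1 / lambda]. *)
Lemma lower_raise (g : nat -> R) (n : nat) :
  lower (raise g) n = raise (lower g) n + g n / lambda.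
Proof.
  unfold lower, raise. destruct n as [|n].
  - simpl. field. lra.
  - rewrite !(S_INR (S n)). simpl pred. field. lra.
Qed.

(** [lower] acts like a derivative: each commutation past a [raise] adds one [1 / lambda]. *)
Lemma lower_charlier (k n : nat) :
  lower (charlier (S k)) n = INR (S k) / lambda * charlier k n.
Proof.
  revert n. induction k as [|k IH]; intros n.
  - unfold lower. cbn [charlier]. rewrite !S_INR. change (INR 0) with 0. field. lra.
  - change (charlier (S (S k))) with (raise (charlier (S k))).
    rewrite lower_raise. unfold raise at 1. rewrite !IH.
    change (charlier (S k) n) with (INR n / lambda * charlier k (pred n) - charlier k n).
    rewrite (S_INR (S k)). field. lra.
Qed.

(** Adjointness moves one [raise] across and lowers both indices, producing the factor
    [(j + 1) / lambda]. The recursion ends on the constant [1], which [lower] annihilates and whose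
    norm is the total Poisson mass. *)
Lemma ip_charlier (k j : nat) :
  ip (charlier k) (charlier j) =
  if Nat.eqb k j then INR (fact k) / lambda ^ k else 0.
Proof.
  assert (H0 : forall i, ip (charlier (S i)) (charlier 0) = 0).
  { intros i. change (charlier (S i)) with (raise (charlier i)).
    rewrite ip_raise by apply exp_bounded_charlier.
    rewrite (ip_ext _ _ (fun n => 0 * 1)) by (intros n; unfold lower; simpl; ring).
    rewrite ip_scal_r. ring. }
  revert j. induction k as [|k IH]; intros [|j].
  - simpl. unfold ip. rewrite (Series_ext _ (fun n => exp (- lambda) * (lambda ^ n / INR (fact n)))).
    + rewrite Series_scal_l.
      rewrite (is_series_unique (fun n => lambda ^ n / INR (fact n)) (exp lambda)).
      * rewrite <- exp_plus, Rplus_opp_l, exp_0. field.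
      * apply (is_series_ext (fun n => scal (pow_n (K := R_AbsRing) lambda n) (/ INR (fact n)))).
        { intros n. rewrite pow_n_pow. reflexivity. }
        apply is_exp_Reals.
    + intros n. simpl. unfold w, poisson_weight. ring.
  - rewrite ip_comm. apply H0.
  - apply H0.
  - change (charlier (S k)) with (raise (charlier k)).
    rewrite ip_raise by apply exp_bounded_charlier.
    rewrite (ip_ext _ _ (fun n => INR (S j) / lambda * charlier j n))
      by (intros; apply lower_charlier).
    rewrite ip_scal_r, IH. simpl Nat.eqb.
    destruct (Nat.eqb_spec k j) as [<-|]; [|ring].
    rewrite fact_simpl, mult_INR. simpl (lambda ^ S k). field.
    split; [apply pow_nonzero|]; lra.
Qed.

Definition charlier_sum (d : nat -> R) (N n : nat) : R :=
  sum_n (fun k => d k * charlier k n) N.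

Lemma exp_bounded_charlier_sum (d : nat -> R) (N : nat) : exp_bounded (charlier_sum d N).
Proof.
  assert (H : forall k, exp_bounded (fun n => d k * charlier k n)).
  { intros k. apply exp_bounded_mult; [apply exp_bounded_const|apply exp_bounded_charlier]. }
  induction N as [|N IH].
  - apply (exp_bounded_ext (fun n => d 0%nat * charlier 0 n)); auto.
    intros n. unfold charlier_sum. now rewrite sum_O.
  - apply (exp_bounded_ext (fun n => charlier_sum d N n + d (S N) * charlier (S N) n)).
    + intros n. unfold charlier_sum. now rewrite sum_Sn.
    + now apply exp_bounded_plus.
Qed.

Lemma ip_charlier_sum_orthogonal (d : nat -> R) (N j : nat) : (N < j)%nat ->
  ip (charlier_sum d N) (charlier j) = 0.
Proof.
  intros HNj. induction N as [|N IH].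
  - rewrite ip_comm, (ip_ext _ _ (fun n => d 0%nat * charlier 0 n)).
    + rewrite ip_scal_r, ip_charlier. destruct (Nat.eqb_spec j 0); [lia|ring].
    + intros n. unfold charlier_sum. now rewrite sum_O.
  - rewrite ip_comm, (ip_ext _ _ (fun n => charlier_sum d N n + d (S N) * charlier (S N) n)).
    + rewrite ip_comm, ip_plus_l.
      * rewrite IH by lia. rewrite ip_comm, ip_scal_r, ip_charlier.
        destruct (Nat.eqb_spec j (S N)); [lia|ring].
      * apply exp_bounded_charlier_sum.
      * apply exp_bounded_mult; [apply exp_bounded_const|apply exp_bounded_charlier].
      * apply exp_bounded_charlier.
    + intros n. unfold charlier_sum. now rewrite sum_Sn.
Qed.

Lemma charlier_sum_norm (d : nat -> R) (N : nat) :
  is_series (fun n => w n * charlier_sum d N n ^ 2)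
    (sum_n (fun k => d k ^ 2 * (INR (fact k) / lambda ^ k)) N).
Proof.
  replace (sum_n (fun k => d k ^ 2 * (INR (fact k) / lambda ^ k)) N)
    with (ip (charlier_sum d N) (charlier_sum d N)).
  - apply (is_series_ext (fun n => w n * (charlier_sum d N n * charlier_sum d N n))).
    { intros n. simpl. now rewrite Rmult_1_r. }
    apply Series_correct.
    apply (ex_series_weight (fun n => charlier_sum d N n * charlier_sum d N n)).
    apply exp_bounded_mult; apply exp_bounded_charlier_sum.
  - assert (Hsc : forall k, ip (fun n => d k * charlier k n) (fun n => d k * charlier k n)
      = d k ^ 2 * (INR (fact k) / lambda ^ k)).
    { intros k. rewrite ip_scal_r, ip_comm, ip_scal_r, ip_charlier, Nat.eqb_refl. ring. }
    induction N as [|N IH].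
    + rewrite sum_O, <- Hsc. unfold charlier_sum.
      apply Series_ext. intros n. now rewrite sum_O.
    + rewrite sum_Sn, <- IH, <- Hsc. change plus with Rplus.
      set (T := charlier_sum d N). set (U := fun n => d (S N) * charlier (S N) n).
      assert (ET : forall n, charlier_sum d (S N) n = T n + U n)
        by (intros n; unfold T, U, charlier_sum; now rewrite sum_Sn).
      assert (HT : exp_bounded T) by apply exp_bounded_charlier_sum.
      assert (HU : exp_bounded U)
        by (apply exp_bounded_mult; [apply exp_bounded_const|apply exp_bounded_charlier]).
      assert (HTU : ip T U = 0).
      { unfold U. rewrite ip_scal_r. unfold T.
        rewrite ip_charlier_sum_orthogonal by lia. ring. }
      transitivity (ip (fun n => T n + U n) (fun n => T n + U n)).
      { apply Series_ext. intros n. now rewrite ET. }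
      assert (HTU' : exp_bounded (fun n => T n + U n)) by now apply exp_bounded_plus.
      rewrite ip_plus_l by auto.
      rewrite (ip_comm T), (ip_comm U (fun n => T n + U n)), !ip_plus_l by auto.
      rewrite (ip_comm U T), HTU. ring.
Qed.

End Charlier.

(** * Limits in a weighted l2 space *)

Lemma sum_n_le_Series (u : nat -> R) (s : R) (m : nat) :
  (forall n, 0 <= u n) -> is_series u s -> sum_n u m <= s.
Proof.
  intros Hu Hs. apply (is_lim_seq_incr_compare (sum_n u) s Hs).
  intros n. rewrite sum_Sn. change plus with Rplus. specialize (Hu (S n)). lra.
Qed.

Lemma is_lim_seq_sum_n (u : nat -> nat -> R) (v : nat -> R) (m : nat) :
  (forall n, is_lim_seq (fun N => u N n) (v n)) ->
  is_lim_seq (fun N => sum_n (u N) m) (sum_n v m).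
Proof.
  intros H. induction m as [|m IH].
  - rewrite sum_O. apply is_lim_seq_ext with (fun N => u N 0%nat); auto.
    intros N. now rewrite sum_O.
  - rewrite sum_Sn. apply is_lim_seq_ext with (fun N => sum_n (u N) m + u N (S m)).
    { intros N. now rewrite sum_Sn. }
    apply is_lim_seq_plus'; auto.
Qed.

Lemma is_lim_seq_Cmod (u : nat -> C) (l : C) :
  is_lim_seq (fun N => Cmod (l - u N)) 0 -> is_lim_seq (fun N => Cmod (u N)) (Cmod l).
Proof.
  intros H. apply is_lim_seq_le_le with
    (fun N => Cmod l - Cmod (l - u N)) (fun N => Cmod l + Cmod (l - u N)).
  - intros N. pose proof (Cmod_rev_triangle l (u N)) as Hr.
    apply Rabs_le_between in Hr. lra.
  - replace (Finite (Cmod l)) with (Finite (Cmod l - 0)) by (f_equal; ring).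
    apply is_lim_seq_minus'; auto. apply is_lim_seq_const.
  - replace (Finite (Cmod l)) with (Finite (Cmod l + 0)) by (f_equal; ring).
    apply is_lim_seq_plus'; auto. apply is_lim_seq_const.
Qed.

Lemma is_lim_seq_weighted_Cmod2 (w : R) (u : nat -> C) (l : C) :
  is_lim_seq (fun N => Cmod (l - u N)) 0 ->
  is_lim_seq (fun N => w * Cmod (u N) ^ 2) (w * Cmod l ^ 2).
Proof.
  intros H. apply is_lim_seq_Cmod in H.
  apply (is_lim_seq_scal_l _ w (Cmod l ^ 2)).
  apply is_lim_seq_ext with (fun N => Cmod (u N) * Cmod (u N)); [intros; simpl; ring|].
  replace (Cmod l ^ 2) with (Cmod l * Cmod l) by (simpl; ring).
  now apply is_lim_seq_mult'.
Qed.

(** Young's inequality; [eta] stays free so that the loss [1 + eta] can be driven to [1]. *)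
Lemma Cmod2_plus_le (eta : R) (x y : C) : 0 < eta ->
  Cmod (x + y) ^ 2 <= (1 + eta) * Cmod x ^ 2 + (1 + / eta) * Cmod y ^ 2.
Proof.
  intros He.
  apply Rle_trans with ((Cmod x + Cmod y) ^ 2).
  { apply pow_incr. split; [apply Cmod_ge_0|apply Cmod_triangle]. }
  apply Rminus_le.
  replace ((Cmod x + Cmod y) ^ 2 - ((1 + eta) * Cmod x ^ 2 + (1 + / eta) * Cmod y ^ 2))
    with (- (/ eta * (eta * Cmod x - Cmod y) ^ 2)) by (field; lra).
  assert (0 <= / eta * (eta * Cmod x - Cmod y) ^ 2).
  { apply Rmult_le_pos; [left; now apply Rinv_0_lt_compat|apply pow2_ge_0]. }
  lra.
Qed.

Section WeightedL2Limit.

Variables (w : nat -> R) (u : nat -> nat -> C) (b : nat -> C) (s : nat -> R) (sigma : R).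
Hypothesis w_pos : forall n, 0 <= w n.
Hypothesis u_lim : forall n, is_lim_seq (fun N => Cmod (b n - u N n)) 0.
Hypothesis u_norm : forall N, is_series (fun n => w n * Cmod (u N n) ^ 2) (s N).
Hypothesis u_diff : forall M N, (M <= N)%nat ->
  is_series (fun n => w n * Cmod (u N n - u M n) ^ 2) (s N - s M).
Hypothesis s_lim : is_lim_seq s sigma.
Hypothesis s_le : forall N, s N <= sigma.

Lemma term_pos (x : nat -> C) (n : nat) : 0 <= w n * Cmod (x n) ^ 2.
Proof. apply Rmult_le_pos; auto. apply pow2_ge_0. Qed.

(** Fatou's lemma by hand: for a fixed number of terms, pointwise convergence passes through the
    finite sum. *)
Lemma limit_sum_le (m : nat) : sum_n (fun n => w n * Cmod (b n) ^ 2) m <= sigma.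
Proof.
  apply (is_lim_seq_le (fun N => sum_n (fun n => w n * Cmod (u N n) ^ 2) m) (fun _ => sigma)
    (sum_n (fun n => w n * Cmod (b n) ^ 2) m) sigma).
  - intros N. apply Rle_trans with (s N); auto.
    apply sum_n_le_Series; auto. apply (term_pos (u N)).
  - apply (is_lim_seq_sum_n (fun N n => w n * Cmod (u N n) ^ 2)).
    intros n. now apply is_lim_seq_weighted_Cmod2.
  - apply is_lim_seq_const.
Qed.

(** The same argument for [u (N + M) - u M], whose squared norm [s (N + M) - s M] is at most
    [sigma - s M]. *)
Lemma limit_diff_sum_le (M m : nat) :
  sum_n (fun n => w n * Cmod (b n - u M n) ^ 2) m <= sigma - s M.
Proof.
  apply (is_lim_seq_le
    (fun N => sum_n (fun n => w n * Cmod (u (N + M)%nat n - u M n) ^ 2) m)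
    (fun _ => sigma - s M)
    (sum_n (fun n => w n * Cmod (b n - u M n) ^ 2) m) (sigma - s M)).
  - intros N. apply Rle_trans with (s (N + M)%nat - s M).
    + apply sum_n_le_Series; [|apply u_diff; lia].
      apply (term_pos (fun n => u (N + M)%nat n - u M n)%C).
    + specialize (s_le (N + M)%nat). lra.
  - apply (is_lim_seq_sum_n (fun N n => w n * Cmod (u (N + M)%nat n - u M n) ^ 2)).
    intros n. apply (is_lim_seq_weighted_Cmod2 (w n) (fun N => u (N + M)%nat n - u M n)%C).
    specialize (u_lim n). apply (is_lim_seq_incr_n _ M) in u_lim.
    revert u_lim. apply is_lim_seq_ext. intros N. f_equal. ring.
  - apply is_lim_seq_const.
Qed.

(** One inequality is [limit_sum_le]. For the other, split [u M] as [b] minus [b - u M] and apply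
    Young's inequality; the second part vanishes as [M -> oo], and then [eta] is made small. *)
Lemma weighted_l2_limit : is_series (fun n => w n * Cmod (b n) ^ 2) sigma.
Proof.
  assert (Hex : ex_series (fun n => w n * Cmod (b n) ^ 2)).
  { destruct (ex_finite_lim_seq_incr (sum_n (fun n => w n * Cmod (b n) ^ 2)) sigma) as [L HL].
    - intros n. rewrite sum_Sn. change plus with Rplus. pose proof (term_pos b (S n)). lra.
    - apply limit_sum_le.
    - now exists L. }
  destruct Hex as [L HL]. replace sigma with L; auto.
  apply Rle_antisym.
  - apply (is_lim_seq_le (sum_n (fun n => w n * Cmod (b n) ^ 2)) (fun _ => sigma) L sigma);
      [apply limit_sum_le|exact HL|apply is_lim_seq_const].
  - assert (HL0 : 0 <= L).
    { eapply Rle_trans; [|apply (sum_n_le_Series _ L 0 (term_pos b) HL)].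
      rewrite sum_O. apply (term_pos b). }
    assert (H : forall eta, 0 < eta -> sigma <= (1 + eta) * L).
    { intros eta He.
      apply (is_lim_seq_le s (fun M => (1 + eta) * L + (1 + / eta) * (sigma - s M))
        sigma ((1 + eta) * L)).
      - intros M.
        apply (is_lim_seq_le (sum_n (fun n => w n * Cmod (u M n) ^ 2))
          (fun _ => (1 + eta) * L + (1 + / eta) * (sigma - s M)) (s M)
          ((1 + eta) * L + (1 + / eta) * (sigma - s M)));
          [|apply u_norm|apply is_lim_seq_const].
        intros m.
        apply Rle_trans with ((1 + eta) * sum_n (fun n => w n * Cmod (b n) ^ 2) m
          + (1 + / eta) * sum_n (fun n => w n * Cmod (b n - u M n) ^ 2) m).
        + induction m as [|m IH].
          * rewrite !sum_O.
            pose proof (Cmod2_plus_le eta (b 0%nat) (- (b 0%nat - u M 0%nat)) He) as Hc.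
            rewrite Cmod_opp in Hc.
            replace (b 0%nat + - (b 0%nat - u M 0%nat))%C with (u M 0%nat) in Hc by ring.
            apply (Rmult_le_compat_l _ _ _ (w_pos 0)) in Hc. lra.
          * rewrite !sum_Sn. change plus with Rplus.
            pose proof (Cmod2_plus_le eta (b (S m)) (- (b (S m) - u M (S m))) He) as Hc.
            rewrite Cmod_opp in Hc.
            replace (b (S m) + - (b (S m) - u M (S m)))%C with (u M (S m)) in Hc by ring.
            apply (Rmult_le_compat_l _ _ _ (w_pos (S m))) in Hc. lra.
        + assert (0 < / eta) by now apply Rinv_0_lt_compat.
          apply Rplus_le_compat; apply Rmult_le_compat_l; try lra.
          * apply sum_n_le_Series; auto. apply (term_pos b).
          * apply limit_diff_sum_le.
      - exact s_lim.
      - replace (Finite ((1 + eta) * L))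
          with (Finite ((1 + eta) * L + (1 + / eta) * (sigma - sigma))) by (f_equal; ring).
        apply is_lim_seq_plus'; [apply is_lim_seq_const|].
        apply (is_lim_seq_scal_l _ (1 + / eta) (sigma - sigma)).
        apply is_lim_seq_minus'; auto. apply is_lim_seq_const. }
    destruct (Rle_lt_dec sigma L) as [|Hlt]; auto.
    (* This [eta] makes [eta * L] at most half of the gap [sigma - L], a contradiction; [L + 1]
       keeps it defined when [L = 0]. *)
    specialize (H ((sigma - L) / (2 * (L + 1)))
      ltac:(apply Rdiv_lt_0_compat; lra)).
    assert ((sigma - L) / (2 * (L + 1)) * L <= (sigma - L) / 2).
    { apply Rmult_le_reg_r with (2 * (L + 1)); [lra|].
      field_simplify; [|lra]. nra. }
    lra.
Qed.

End WeightedL2Limit.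

(** * Charlier sums with complex coefficients *)

Definition charlier_Csum (lambda : R) (c : nat -> C) (N n : nat) : C :=
  sum_n (fun k => c k * RtoC (charlier lambda k n))%C N.

Lemma charlier_Csum_parts (lambda : R) (c : nat -> C) (N n : nat) :
  charlier_Csum lambda c N n =
  (charlier_sum lambda (fun k => Re (c k)) N n, charlier_sum lambda (fun k => Im (c k)) N n).
Proof.
  unfold charlier_Csum, charlier_sum.
  assert (E : forall k, (c k * RtoC (charlier lambda k n))%C
    = (Re (c k) * charlier lambda k n, Im (c k) * charlier lambda k n)).
  { intros k. unfold Cmult, RtoC, Re, Im; simpl. f_equal; ring. }
  induction N as [|N IH].
  - now rewrite !sum_O, E.
  - rewrite !sum_Sn, IH, E. reflexivity.
Qed.

Lemma charlier_Csum_norm (lambda : R) (c : nat -> C) (N : nat) : 0 < lambda ->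
  is_series (fun n => poisson_weight lambda n * Cmod (charlier_Csum lambda c N n) ^ 2)
    (sum_n (fun k => Cmod (c k) ^ 2 * (INR (fact k) / lambda ^ k)) N).
Proof.
  intros Hl.
  pose proof (is_series_plus _ _ _ _ (charlier_sum_norm lambda Hl (fun k => Re (c k)) N)
    (charlier_sum_norm lambda Hl (fun k => Im (c k)) N)) as H.
  replace (sum_n (fun k => Cmod (c k) ^ 2 * (INR (fact k) / lambda ^ k)) N)
    with (plus (sum_n (fun k => Re (c k) ^ 2 * (INR (fact k) / lambda ^ k)) N)
            (sum_n (fun k => Im (c k) ^ 2 * (INR (fact k) / lambda ^ k)) N)).
  - revert H. apply is_series_ext. intros n. rewrite charlier_Csum_parts, Cmod2_alt.
    unfold Re, Im; simpl fst; simpl snd. change plus with Rplus. eqR. ring.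
  - rewrite <- sum_n_plus. apply sum_n_ext. intros k. rewrite Cmod2_alt.
    change plus with Rplus. eqR. ring.
Qed.

(** Replacing the coefficients of index at most [M] by zero turns the difference into a full sum, to
    which [charlier_Csum_norm] applies. *)
Lemma charlier_Csum_diff_norm (lambda : R) (c : nat -> C) (M N : nat) : 0 < lambda ->
  (M <= N)%nat ->
  is_series (fun n => poisson_weight lambda n *
      Cmod (charlier_Csum lambda c N n - charlier_Csum lambda c M n) ^ 2)
    (sum_n (fun k => Cmod (c k) ^ 2 * (INR (fact k) / lambda ^ k)) N
     - sum_n (fun k => Cmod (c k) ^ 2 * (INR (fact k) / lambda ^ k)) M).
Proof.
  intros Hl HMN.
  set (d := fun k => if Nat.leb k M then RtoC 0 else c k).
  assert (Hd0 : forall k, (k <= M)%nat -> d k = RtoC 0).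
  { intros k Hk. unfold d. now rewrite (proj2 (Nat.leb_le k M) Hk). }
  assert (Hd1 : forall k, (M < k)%nat -> d k = c k).
  { intros k Hk. unfold d. now rewrite (proj2 (Nat.leb_gt k M) Hk). }
  assert (EM : forall n, charlier_Csum lambda d M n = RtoC 0).
  { intros n. unfold charlier_Csum.
    assert (Hz : forall K, (K <= M)%nat ->
      sum_n (fun k => d k * RtoC (charlier lambda k n))%C K = RtoC 0).
    { induction K as [|K IH]; intros HK.
      - rewrite sum_O, Hd0 by auto. cring.
      - rewrite sum_Sn, IH, Hd0 by lia. change (@plus C_AbelianMonoid) with Cplus. cring. }
    now apply Hz. }
  assert (SM : sum_n (fun k => Cmod (d k) ^ 2 * (INR (fact k) / lambda ^ k)) M = 0).
  { assert (Hz : forall K, (K <= M)%nat ->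
      sum_n (fun k => Cmod (d k) ^ 2 * (INR (fact k) / lambda ^ k)) K = 0).
    { induction K as [|K IH]; intros HK.
      - rewrite sum_O, Hd0, Cmod_0 by auto. eqR. ring.
      - rewrite sum_Sn, IH, Hd0, Cmod_0 by lia. change plus with Rplus. eqR. ring. }
    now apply Hz. }
  replace (_ - _) with (sum_n (fun k => Cmod (d k) ^ 2 * (INR (fact k) / lambda ^ k)) N).
  - pose proof (charlier_Csum_norm lambda d N Hl) as H. revert H.
    apply is_series_ext. intros n. do 3 f_equal.
    induction HMN as [|N HMN IH].
    + rewrite EM. ring.
    + unfold charlier_Csum in *. rewrite (sum_Sn _ N), IH, (sum_Sn _ N), Hd1 by lia.
      change (@plus C_AbelianMonoid) with Cplus. cring.
  - induction HMN as [|N HMN IH].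
    + rewrite SM. eqR. ring.
    + rewrite (sum_Sn _ N), IH, (sum_Sn _ N), Hd1 by lia. change plus with Rplus. eqR. ring.
Qed.

(** * Factorial moments as integrals *)

(** The lower incomplete gamma function at [k + 1], unfolded by integration by parts. *)
Fixpoint gamma_part (k : nat) (T : R) : R :=
  match k with
  | 0%nat => 1 - exp (- T)
  | S j => INR (S j) * gamma_part j T - T ^ S j * exp (- T)
  end.

Lemma is_RInt_gamma_part (k : nat) (T : R) :
  is_RInt (fun r => r ^ k * exp (- r)) 0 T (gamma_part k T).
Proof.
  induction k as [|k IH].
  - replace (gamma_part 0 T) with (minus (- exp (- T)) (- exp (- 0))).
    + apply (is_RInt_derive (V := R_CompleteNormedModule) (fun r => - exp (- r))).
      * intros r _. auto_derive; auto. simpl. ring.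
      * intros r _. apply (ex_derive_continuous (V := R_NormedModule)). auto_derive. auto.
    + rewrite Ropp_0, exp_0. unfold minus, plus, opp; simpl. ring.
  - set (F := fun r => - (r ^ S k * exp (- r))).
    replace (gamma_part (S k) T)
      with (plus (scal (INR (S k)) (gamma_part k T)) (minus (F T) (F 0))).
    + apply (is_RInt_ext (V := R_NormedModule)
        (fun r => plus (scal (INR (S k)) (r ^ k * exp (- r)))
          (r ^ S k * exp (- r) - INR (S k) * r ^ k * exp (- r)))).
      { intros r _. unfold plus, scal; simpl plus; unfold mult; simpl mult. rring. }
      apply (is_RInt_plus (V := R_NormedModule)).
      * now apply (is_RInt_scal (V := R_NormedModule)).
      * apply (is_RInt_derive (V := R_CompleteNormedModule)).
        -- intros r _. unfold F. auto_derive; auto.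
           simpl pred. change (r * r ^ k) with (r ^ S k). change (match k with 0%nat => 1 | S _ => INR k + 1 end) with (INR (S k)). eqR. ring.
        -- intros r _. apply (ex_derive_continuous (V := R_NormedModule)). auto_derive. auto.
    + change (INR (S k) * gamma_part k T + (F T - F 0) = gamma_part (S k) T).
      unfold F. change (gamma_part (S k) T)
        with (INR (S k) * gamma_part k T - T ^ S k * exp (- T)).
      rewrite (pow_i (S k)) by lia. ring.
Qed.

Lemma gamma_part_le (k : nat) (T : R) : 0 <= T -> gamma_part k T <= INR (fact k).
Proof.
  intros HT. induction k as [|k IH].
  - simpl. pose proof (exp_pos (- T)). lra.
  - change (gamma_part (S k) T)
      with (INR (S k) * gamma_part k T - T ^ S k * exp (- T)).
    rewrite fact_simpl, mult_INR.
    assert (0 <= T ^ S k * exp (- T))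
      by (apply Rmult_le_pos; [now apply pow_le|left; apply exp_pos]).
    assert (INR (S k) * gamma_part k T <= INR (S k) * INR (fact k))
      by (apply Rmult_le_compat_l; auto; apply pos_INR).
    lra.
Qed.

(** The single Taylor term of degree [k + 1] of [exp T] already gives the bound [(k + 1)! / T]. *)
Lemma is_lim_pow_exp_neg (k : nat) : is_lim (fun T => T ^ k * exp (- T)) p_infty 0.
Proof.
  apply (is_lim_le_le_loc (fun _ => 0) (fun T => INR (fact (S k)) * / T)).
  - exists 0. intros T HT. split.
    + apply Rmult_le_pos; [left; now apply pow_lt|left; apply exp_pos].
    + pose proof (pow_fact_bounded T (S k) ltac:(lra)) as H.
      pose proof (INR_fact_lt_0 (S k)). rewrite exp_Ropp.
      pose proof (exp_pos T).
      apply Rmult_le_reg_r with (exp T * T); [now apply Rmult_lt_0_compat|].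
      replace (T ^ k * / exp T * (exp T * T)) with (T ^ S k) by (simpl; field; lra).
      replace (INR (fact (S k)) * / T * (exp T * T)) with (INR (fact (S k)) * exp T)
        by (field; lra).
      apply (Rmult_le_compat_l (INR (fact (S k)))) in H; [|lra].
      replace (INR (fact (S k)) * (T ^ S k / INR (fact (S k)))) with (T ^ S k) in H
        by (field; lra). lra.
  - apply is_lim_const.
  - replace (Finite 0) with (Rbar_mult (INR (fact (S k))) 0) by (simpl; f_equal; ring).
    apply is_lim_scal_l. apply (is_lim_inv (fun T => T) p_infty p_infty).
    + apply is_lim_id.
    + discriminate.
Qed.

Lemma is_lim_gamma_part (k : nat) : is_lim (gamma_part k) p_infty (INR (fact k)).
Proof.
  induction k as [|k IH].
  - replace (Finite (INR (fact 0))) with (Finite (1 - 0)) by (simpl; f_equal; ring).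
    apply (is_lim_minus' (fun _ => 1) (fun T => exp (- T)) p_infty 1 0).
    + apply is_lim_const.
    + apply (is_lim_ext (fun T => T ^ 0 * exp (- T))); [intros; simpl; ring|].
      apply (is_lim_pow_exp_neg 0).
  - replace (Finite (INR (fact (S k)))) with (Finite (INR (S k) * INR (fact k) - 0))
      by (f_equal; rewrite fact_simpl, mult_INR; ring).
    apply (is_lim_minus' (fun T => INR (S k) * gamma_part k T)
      (fun T => T ^ S k * exp (- T)) p_infty (INR (S k) * INR (fact k)) 0).
    + apply (is_lim_scal_l (gamma_part k) (INR (S k)) p_infty (INR (fact k))), IH.
    + apply is_lim_pow_exp_neg.
Qed.

Section LaplaceTransform.

Variable p : nat -> R.
Hypothesis p_pos : forall k, 0 <= p k.
Hypothesis p_radius : CV_radius p = p_infty.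

Let part (N : nat) (r : R) : R := sum_n (fun k => p k * r ^ k) N.
Let moment (N : nat) (T : R) : R := sum_n (fun k => p k * gamma_part k T) N.

Lemma part_S (N : nat) (r : R) : part (S N) r = part N r + p (S N) * r ^ S N.
Proof. unfold part. now rewrite sum_Sn. Qed.

Lemma is_lim_seq_part (r : R) : is_lim_seq (fun N => part N r) (PSeries p r).
Proof.
  assert (H : is_pseries p r (PSeries p r)).
  { apply PSeries_correct, CV_radius_inside. rewrite p_radius. exact I. }
  change (is_lim_seq (sum_n (fun k => scal (pow_n (K := R_AbsRing) r k) (p k))) (PSeries p r))
    in H.
  revert H. apply is_lim_seq_ext. intros N.
  apply sum_n_ext. intros k. rewrite pow_n_pow. apply Rmult_comm.
Qed.

Lemma part_le_PSeries (N : nat) (r : R) : 0 <= r -> part N r <= PSeries p r.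
Proof.
  intros Hr. apply (is_lim_seq_incr_compare (fun N => part N r)); [apply is_lim_seq_part|].
  intros n. rewrite part_S.
  assert (0 <= p (S n) * r ^ S n) by (apply Rmult_le_pos; auto; now apply pow_le). lra.
Qed.

(** A tail with nonnegative coefficients increases with [r], so the error at [T] controls the error
    on all of [[0, T]]. *)
Lemma PSeries_tail_le (N : nat) (r T : R) : 0 <= r <= T ->
  PSeries p r - part N r <= PSeries p T - part N T.
Proof.
  intros Hr.
  apply (is_lim_seq_le (fun n => part (n + N) r - part N r) (fun n => part (n + N) T - part N T)
    (PSeries p r - part N r) (PSeries p T - part N T)).
  - intros n. induction n as [|n IH]; [simpl; lra|].
    simpl Nat.add. rewrite !part_S.
    assert (p (S (n + N)) * r ^ S (n + N) <= p (S (n + N)) * T ^ S (n + N)).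
    { apply Rmult_le_compat_l; auto. now apply pow_incr. }
    lra.
  - apply is_lim_seq_minus'; [|apply is_lim_seq_const].
    apply (is_lim_seq_incr_n (fun n => part n r) N), is_lim_seq_part.
  - apply is_lim_seq_minus'; [|apply is_lim_seq_const].
    apply (is_lim_seq_incr_n (fun n => part n T) N), is_lim_seq_part.
Qed.

Lemma is_RInt_part (N : nat) (T : R) :
  is_RInt (fun r => part N r * exp (- r)) 0 T (moment N T).
Proof.
  assert (Hk : forall k, is_RInt (fun r => p k * r ^ k * exp (- r)) 0 T (p k * gamma_part k T)).
  { intros k. apply (is_RInt_ext (V := R_NormedModule)
      (fun r => scal (p k) (r ^ k * exp (- r)))).
    { intros r _. symmetry. apply Rmult_assoc. }
    apply (is_RInt_scal (V := R_NormedModule)), is_RInt_gamma_part. }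
  induction N as [|N IH].
  - unfold moment. rewrite sum_O. generalize (Hk 0%nat).
    apply (is_RInt_ext (V := R_NormedModule)). intros r _. unfold part. now rewrite sum_O.
  - unfold moment. rewrite sum_Sn.
    generalize (is_RInt_plus (V := R_NormedModule) _ _ _ _ _ _ IH (Hk (S N))).
    apply (is_RInt_ext (V := R_NormedModule)). intros r _. rewrite part_S.
    change plus with Rplus. eqR. ring.
Qed.

Lemma continuous_PSeries_exp (r : R) : continuous (fun r => PSeries p r * exp (- r)) r.
Proof.
  apply (continuous_mult (K := R_AbsRing) (PSeries p) (fun r => exp (- r))).
  - apply continuity_pt_filterlim, PSeries_continuity. rewrite p_radius. exact I.
  - apply (ex_derive_continuous (V := R_NormedModule)). auto_derive. auto.
Qed.

Lemma is_RInt_PSeries_exp (T : R) :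
  is_RInt (fun r => PSeries p r * exp (- r)) 0 T (RInt (fun r => PSeries p r * exp (- r)) 0 T).
Proof.
  apply (RInt_correct (V := R_CompleteNormedModule)).
  apply (ex_RInt_continuous (V := R_CompleteNormedModule)).
  intros; apply continuous_PSeries_exp.
Qed.

Lemma moment_le_RInt (N : nat) (T : R) : 0 <= T ->
  moment N T <= RInt (fun r => PSeries p r * exp (- r)) 0 T.
Proof.
  intros HT. apply (is_RInt_le _ _ 0 T _ _ HT (is_RInt_part N T) (is_RInt_PSeries_exp T)).
  intros r Hr. apply Rmult_le_compat_r; [left; apply exp_pos|].
  apply part_le_PSeries. lra.
Qed.

Lemma is_lim_moment (N : nat) :
  is_lim (moment N) p_infty (sum_n (fun k => p k * INR (fact k)) N).
Proof.
  assert (Hk : forall k, is_lim (fun T => p k * gamma_part k T) p_infty (p k * INR (fact k))).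
  { intros k. apply (is_lim_scal_l (gamma_part k) (p k) p_infty (INR (fact k))).
    apply is_lim_gamma_part. }
  unfold moment. induction N as [|N IH].
  - rewrite sum_O. apply (is_lim_ext (fun T => p 0%nat * gamma_part 0 T)); auto.
    intros T. now rewrite sum_O.
  - rewrite sum_Sn.
    apply (is_lim_ext (fun T => sum_n (fun k => p k * gamma_part k T) N
      + p (S N) * gamma_part (S N) T)).
    { intros T. now rewrite sum_Sn. }
    now apply is_lim_plus'.
Qed.

(** The truncated moment is at most the integral of [K * exp ((alpha - 1) * r)] over [[0, T]], which
    stays below [K / (1 - alpha)]; then [T -> oo]. *)
Lemma factorial_moments_bounded (K alpha : R) (N : nat) : alpha < 1 ->
  (forall r, 0 <= r -> PSeries p r <= K * exp (alpha * r)) ->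
  sum_n (fun k => p k * INR (fact k)) N <= K / (1 - alpha).
Proof.
  intros Ha HK.
  assert (HK0 : 0 <= K).
  { specialize (HK 0 (Rle_refl 0)). rewrite Rmult_0_r, exp_0, PSeries_0 in HK.
    specialize (p_pos 0%nat). lra. }
  assert (H : forall T, 0 <= T -> moment N T <= K / (1 - alpha)).
  { intros T HT.
    set (F := fun r => - (K / (1 - alpha)) * exp ((alpha - 1) * r)).
    assert (HI : is_RInt (fun r => K * exp (alpha * r) * exp (- r)) 0 T (minus (F T) (F 0))).
    { apply (is_RInt_derive (V := R_CompleteNormedModule)).
      - intros r _. unfold F. auto_derive; auto.
        rewrite (Rmult_assoc K), <- exp_plus.
        replace (alpha * r + - r) with ((alpha - 1) * r) by ring. field. lra.
      - intros r _. apply (ex_derive_continuous (V := R_NormedModule)). auto_derive. auto. }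
    apply Rle_trans with (F T - F 0).
    - apply (is_RInt_le _ _ 0 T _ _ HT (is_RInt_part N T) HI).
      intros r Hr. apply Rmult_le_compat_r; [left; apply exp_pos|].
      apply Rle_trans with (PSeries p r); [apply part_le_PSeries|apply HK]; lra.
    - unfold F. rewrite Rmult_0_r, exp_0.
      assert (0 <= K / (1 - alpha) * exp ((alpha - 1) * T)).
      { apply Rmult_le_pos; [apply Rdiv_le_0_compat; lra|left; apply exp_pos]. }
      lra. }
  apply (is_lim_le_loc (moment N) (fun _ => K / (1 - alpha)) p_infty
    (sum_n (fun k => p k * INR (fact k)) N) (K / (1 - alpha))).
  - exists 0. intros T HT. apply H. lra.
  - apply is_lim_moment.
  - apply is_lim_const.
Qed.

(** Termwise integration by squeezing the truncated integral [J T]. Above, the partial sums plus a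
    uniform error on [[0, T]] give [sigma]; below, the moments of one fixed partial sum come as
    close to [sigma] as desired. The two halves of [eps] pay for the choice of [N] and of [T]. *)
Lemma is_RInt_gen_PSeries_exp (sigma : R) (h : R -> R) :
  is_series (fun k => p k * INR (fact k)) sigma ->
  (forall r, 0 < r -> h r = PSeries p r * exp (- r)) ->
  is_RInt_gen h (at_point 0) (Rbar_locally p_infty) sigma.
Proof.
  intros Hs Hh.
  set (J := fun T => RInt (fun r => PSeries p r * exp (- r)) 0 T).
  assert (Hup : forall T, 0 <= T -> J T <= sigma).
  { intros T HT.
    apply (is_lim_seq_le (fun _ => J T) (fun N => sigma + T * (PSeries p T - part N T))
      (J T) sigma).
    - intros N. apply Rle_trans with (moment N T + T * (PSeries p T - part N T)).
      + assert (HI : is_RInt (fun r => part N r * exp (- r) + (PSeries p T - part N T)) 0 T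
          (moment N T + T * (PSeries p T - part N T))).
        { replace (T * (PSeries p T - part N T))
            with (scal (T - 0) (PSeries p T - part N T)) by rring.
          apply (is_RInt_plus (V := R_NormedModule)); [apply is_RInt_part|].
          apply (is_RInt_const (V := R_NormedModule)). }
        apply (is_RInt_le _ _ 0 T _ _ HT (is_RInt_PSeries_exp T) HI).
        intros r Hr. pose proof (PSeries_tail_le N r T ltac:(lra)) as Ht.
        pose proof (part_le_PSeries N r ltac:(lra)) as Hp.
        assert (He : 0 < exp (- r) <= 1).
        { split; [apply exp_pos|]. rewrite <- exp_0. left. apply exp_increasing. lra. }
        assert ((PSeries p r - part N r) * exp (- r) <= (PSeries p r - part N r) * 1)
          by (apply Rmult_le_compat_l; lra).
        lra.
      + apply Rplus_le_compat_r.
        apply Rle_trans with (sum_n (fun k => p k * INR (fact k)) N).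
        * unfold moment. apply sum_n_m_le. intros k.
          apply Rmult_le_compat_l; auto. now apply gamma_part_le.
        * apply sum_n_le_Series; auto. intros k. apply Rmult_le_pos; auto. apply pos_INR.
    - apply is_lim_seq_const.
    - replace (Finite sigma) with (Finite (sigma + T * (PSeries p T - PSeries p T)))
        by (f_equal; ring).
      apply is_lim_seq_plus'; [apply is_lim_seq_const|].
      apply (is_lim_seq_scal_l _ T (PSeries p T - PSeries p T)).
      apply is_lim_seq_minus'; [apply is_lim_seq_const|apply is_lim_seq_part]. }
  intros P [eps HP].
  assert (He2 : 0 < eps / 2) by (destruct eps; simpl; lra).
  assert (HN : exists N, sigma - eps / 2 < sum_n (fun k => p k * INR (fact k)) N).
  { assert (Hs' : is_lim_seq (sum_n (fun k => p k * INR (fact k))) sigma) by exact Hs.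
    apply is_lim_seq_spec in Hs'. destruct (Hs' (mkposreal _ He2)) as [N HN].
    exists N. specialize (HN N (Nat.le_refl N)). apply Rabs_lt_between in HN.
    simpl in HN. lra. }
  destruct HN as [N HN].
  pose proof (is_lim_moment N) as Hm. apply is_lim_spec in Hm.
  destruct (Hm (mkposreal _ He2)) as [T0 HT0].
  apply (Filter_prod _ _ _ (fun x => x = 0) (fun T => Rmax T0 0 < T)).
  - reflexivity.
  - now exists (Rmax T0 0).
  - intros x T -> HT. exists (J T).
    assert (H0T : 0 < T) by (eapply Rle_lt_trans; [apply Rmax_r|exact HT]).
    split.
    + generalize (is_RInt_PSeries_exp T). apply (is_RInt_ext (V := R_NormedModule)).
      simpl fst; simpl snd. rewrite Rmin_left by lra. intros r Hr.
      symmetry. apply Hh. lra.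
    + apply HP. change (Rabs (J T - sigma) < eps).
      assert (HT0' : T0 < T) by (eapply Rle_lt_trans; [apply Rmax_l|exact HT]).
      specialize (HT0 T HT0'). simpl in HT0. apply Rabs_lt_between in HT0.
      pose proof (moment_le_RInt N T ltac:(lra)) as Hlo. fold (J T) in Hlo.
      specialize (Hup T ltac:(lra)).
      apply Rabs_lt_between. lra.
Qed.

End LaplaceTransform.

(** * The two sides of the identity *)

Section TaylorAtOne.

Variables (f : C -> C) (c : nat -> C).
Hypothesis Hc : forall w, psums c w (f (1 + w)%C).

Lemma entire_geometric (rho : R) : 0 <= rho -> exists M q, geometric c rho M q.
Proof.
  intros Hrho. apply (psums_geometric c (RtoC (rho + 1)) _ rho (Hc _)).
  rewrite Cmod_R, Rabs_pos_eq; lra.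
Qed.

Lemma is_RInt_circle (rho : R) : 0 <= rho ->
  is_RInt (fun t => Cmod (f (1 + RtoC rho * Cexp (Ci * RtoC t))%C) ^ 2) (- PI) PI
    (2 * PI * Series (fun k => Cmod (c k) ^ 2 * rho ^ (2 * k))).
Proof.
  intros Hrho. destruct (entire_geometric rho Hrho) as (M & q & Hg).
  destruct (parseval c rho M q (fun t => f (1 + RtoC rho * cis t)%C)) as [HI _]; auto.
  revert HI. apply (is_RInt_ext (V := R_NormedModule)).
  intros t _. now rewrite Cexp_cis.
Qed.

Lemma circle_mean_Series (rho : R) : 0 <= rho ->
  circle_mean f rho = Series (fun k => Cmod (c k) ^ 2 * rho ^ (2 * k)).
Proof.
  intros Hrho. pose proof PI_RGT_0. unfold circle_mean.
  rewrite (is_RInt_unique (V := R_CompleteNormedModule) _ _ _ _ (is_RInt_circle rho Hrho)).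
  field. lra.
Qed.

Lemma circle_mean_le (rho B : R) : 0 <= rho ->
  (forall w, Cmod w = rho -> Cmod (f (1 + w)%C) <= B) -> circle_mean f rho <= B ^ 2.
Proof.
  intros Hrho HB. pose proof PI_RGT_0 as HPI. rewrite circle_mean_Series by auto.
  assert (H : 2 * PI * Series (fun k => Cmod (c k) ^ 2 * rho ^ (2 * k)) <= (PI - - PI) * B ^ 2).
  { apply (is_RInt_le _ (fun _ => B ^ 2) (- PI) PI _ _ ltac:(lra) (is_RInt_circle rho Hrho)).
    - apply (is_RInt_const (V := R_NormedModule)).
    - intros t _. apply pow_incr. split; [apply Cmod_ge_0|].
      apply HB. now rewrite Cexp_cis, Cmod_Rmult_cis. }
  apply Rmult_le_reg_l with (2 * PI); lra.
Qed.

(** Where the bound at infinity is silent, [Cmod (1 + w) < M0], hence [Cmod w <= Rabs M0 + 1], and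
    the series bounds [f] by [B]. Since [0 <= H] the exponential is at least [1], so both bounds can
    be added; [Rabs] is there because [K0] and [M0] have no prescribed sign. *)
Lemma big_O_global (H : R) : 0 <= H ->
  big_O_at_infinity f (fun z => exp (H * Cmod (z - 1)%C ^ 2)) ->
  exists K, 0 <= K /\ forall w, Cmod (f (1 + w)%C) <= K * exp (H * Cmod w ^ 2).
Proof.
  intros HH (K0 & M0 & HK).
  destruct (entire_geometric (Rabs M0 + 1)) as (M & q & Hg);
    [pose proof (Rabs_pos M0); lra|].
  set (B := Cmod (c 0%nat) + M * q ^ 1 / (1 - q)).
  assert (HB : forall w, Cmod w <= Rabs M0 + 1 -> Cmod (f (1 + w)%C) <= B).
  { intros w Hw.
    pose proof (psums_tail c _ M q w _ 0 Hg Hw (Hc w)) as Ht. rewrite psum_O in Ht.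
    replace (f (1 + w)%C) with (c 0%nat + (f (1 + w) - c 0%nat))%C by ring.
    eapply Rle_trans; [apply Cmod_triangle|]. unfold B. lra. }
  assert (HB0 : 0 <= B).
  { eapply Rle_trans; [apply Cmod_ge_0|]. apply (HB 0%C).
    rewrite Cmod_0. pose proof (Rabs_pos M0); lra. }
  exists (Rabs K0 + B). split; [pose proof (Rabs_pos K0); lra|].
  intros w.
  assert (He : 1 <= exp (H * Cmod w ^ 2)).
  { pose proof (exp_ineq1_le (H * Cmod w ^ 2)).
    assert (0 <= H * Cmod w ^ 2) by (apply Rmult_le_pos; auto; apply pow2_ge_0). lra. }
  rewrite Rmult_plus_distr_r.
  destruct (Rle_lt_dec M0 (Cmod (1 + w))) as [Hlt|Hlt].
  - specialize (HK _ Hlt). replace (1 + w - 1)%C with w in HK by ring.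
    assert (K0 * exp (H * Cmod w ^ 2) <= Rabs K0 * exp (H * Cmod w ^ 2))
      by (apply Rmult_le_compat_r; [lra|apply Rle_abs]).
    assert (0 <= B * exp (H * Cmod w ^ 2)) by (apply Rmult_le_pos; lra). lra.
  - assert (Hw : Cmod (f (1 + w)%C) <= B).
    { apply HB. replace w with ((1 + w) + - (1))%C by ring.
      eapply Rle_trans; [apply Cmod_triangle|]. rewrite Cmod_opp, Cmod_1.
      pose proof (Rle_abs M0). lra. }
    assert (B * 1 <= B * exp (H * Cmod w ^ 2)) by now apply Rmult_le_compat_l.
    assert (0 <= Rabs K0 * exp (H * Cmod w ^ 2))
      by (apply Rmult_le_pos; [apply Rabs_pos|lra]). lra.
Qed.

Section Scaled.

Variable lambda : R.
Hypothesis Hl : 0 < lambda.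

(** Coefficients of the circle mean as a power series in [r], after substituting
    [rho ^ 2 = r / lambda]; multiplied by [k!] they are the squared norms of [c_k C_k]. *)
Definition scaled_coeff (k : nat) : R := Cmod (c k) ^ 2 / lambda ^ k.

Lemma scaled_coeff_pos (k : nat) : 0 <= scaled_coeff k.
Proof. apply Rdiv_le_0_compat; [apply pow2_ge_0|now apply pow_lt]. Qed.

Lemma scaled_coeff_pow (k : nat) (r : R) : 0 <= r ->
  scaled_coeff k * r ^ k = Cmod (c k) ^ 2 * sqrt (r / lambda) ^ (2 * k).
Proof.
  intros Hr. rewrite pow_mult, pow2_sqrt by (apply Rdiv_le_0_compat; lra).
  unfold scaled_coeff, Rdiv. rewrite Rpow_mult_distr, pow_inv. ring.
Qed.

Lemma scaled_coeff_radius : CV_radius scaled_coeff = p_infty.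
Proof.
  apply CV_radius_entire. intros x Hx.
  destruct (psums_terms_bounded c _ _ (Hc (RtoC (sqrt (x / lambda))))) as (M & HM & H).
  exists (M ^ 2). intros n.
  rewrite Rabs_pos_eq by (apply Rmult_le_pos; [apply scaled_coeff_pos|now apply pow_le]).
  rewrite scaled_coeff_pow, Nat.mul_comm, pow_mult, <- Rpow_mult_distr by auto.
  specialize (H n). rewrite Cmod_R, Rabs_pos_eq in H by apply sqrt_pos.
  apply pow_incr. split; auto.
  apply Rmult_le_pos; [apply Cmod_ge_0|apply pow_le, sqrt_pos].
Qed.

Lemma circle_mean_PSeries (r : R) : 0 <= r ->
  circle_mean f (sqrt (r / lambda)) = PSeries scaled_coeff r.
Proof.
  intros Hr. rewrite circle_mean_Series by apply sqrt_pos.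
  apply Series_ext. intros k. symmetry. now apply scaled_coeff_pow.
Qed.

(** The numbers [A n - w n * charlier_Csum lambda c N n] are the Taylor coefficients at [0] of
    [exp (lambda (z - 1))] times the remainder of order [N] of [f] at [1]. This product is uniformly
    small on a circle around [0], so Cauchy's estimate makes each coefficient small. *)
Lemma taylor_at_0_approx (A : nat -> C) (n : nat) :
  taylor_coeffs (fun z => (Cexp (RtoC lambda * (z - 1)) * f z)%C) 0%C A ->
  is_lim_seq (fun N => Cmod (A n / RtoC (poisson_weight lambda n)
                             - charlier_Csum lambda c N n)) 0.
Proof.
  intros (r & Hr & HA).
  set (rho := r / 2). assert (Hrho : 0 < rho < r) by (unfold rho; lra).
  (* The expansion is centred at [1], and the circle of radius [rho] around [0] lies in the disc of
     radius [rho + 1] around [1]. *)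
  destruct (entire_geometric (rho + 1)) as (M & q & Hg); [lra|].
  pose proof (poisson_weight_pos lambda Hl n) as Hw. fold (poisson_weight lambda n) in Hw.
  set (w := poisson_weight lambda n) in *.
  assert (Hd : forall N, Cmod (A n - RtoC w * charlier_Csum lambda c N n) * rho ^ n
     <= exp (lambda * rho) * (M * q ^ S N / (1 - q))).
  { intros N.
    apply (cauchy_estimate
      (fun n => A n - RtoC (poisson_weight lambda n) * charlier_Csum lambda c N n)%C r rho
      (exp (lambda * rho) * (M * q ^ S N / (1 - q)))
      (fun z => Cexp (RtoC lambda * (z - 1)) * (f z - psum c (z - 1) N))%C n Hrho).
    - intros z Hz.
      replace (Cexp (RtoC lambda * (z - 1)) * (f z - psum c (z - 1) N))%C
        with (Cexp (RtoC lambda * (z - 1)) * f z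
              - sum_n (fun k => c k * (Cexp (RtoC lambda * (z - 1)) * (z - 1) ^ k)) N)%C.
      + apply psums_minus.
        * apply psums_is_pseries. generalize (HA z Hz).
          now replace (0 + z)%C with z by ring.
        * apply (psums_ext (fun n => sum_n (fun k => c k *
              RtoC (poisson_weight lambda n * charlier lambda k n))%C N) _ z
              (sum_n (fun k => c k * (Cexp (RtoC lambda * (z - 1)) * (z - 1) ^ k))%C N));
            [|reflexivity|].
          -- intros m. unfold charlier_Csum.
             induction N as [|N IH]; [rewrite !sum_O|rewrite !sum_Sn, IH];
               change (@plus C_AbelianMonoid) with Cplus; rewrite RtoC_mult; cring.
          -- apply (psums_sum (fun k n => c k *
               RtoC (poisson_weight lambda n * charlier lambda k n))%C).
             intros k. apply psums_scal. now apply charlier_psums.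
      + unfold psum. clear. induction N as [|N IH].
        * rewrite !sum_O. ring.
        * rewrite !sum_Sn. change (@plus C_AbelianMonoid) with Cplus.
          (* The inductive hypothesis is solved for its partial sum, which is [e * s], before
             rewriting. *)
          match type of IH with (?x - ?y = ?e * (_ - ?s))%C =>
            replace y with (e * s)%C by (transitivity (x - (x - y))%C; [rewrite IH|]; ring)
          end. ring.
    - intros z Hz. rewrite Cmod_mult. apply Rmult_le_compat; try apply Cmod_ge_0.
      + unfold Cexp. set (x := Re (RtoC lambda * (z - 1))).
        set (y := Im (RtoC lambda * (z - 1))).
        replace (exp x * cos y, exp x * sin y) with (RtoC (exp x) * cis y)%C
          by (unfold cis, RtoC, Cmult; simpl; f_equal; ring).
        rewrite Cmod_Rmult_cis by (left; apply exp_pos).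
        assert (Hx : x <= lambda * rho);
          [|destruct Hx as [Hx| ->]; [left; now apply exp_increasing|apply Rle_refl]].
        unfold x. pose proof (re_le_Cmod z) as Hre.
        pose proof (Rle_abs (Re z)).
        replace (Re (RtoC lambda * (z - 1))) with (lambda * (Re z - 1))
          by (destruct z; unfold Re; simpl; ring).
        apply Rmult_le_compat_l; lra.
      + apply (psums_tail c (rho + 1)); auto.
        * eapply Rle_trans; [apply Cmod_triangle|]. rewrite Cmod_opp, Cmod_1. lra.
        * generalize (Hc (z - 1)%C). now replace (1 + (z - 1))%C with z by ring. }
  set (K := exp (lambda * rho) / (w * rho ^ n)).
  assert (Hrn : 0 < rho ^ n) by now apply pow_lt.
  apply is_lim_seq_0_le with (fun N => K * (M * q ^ S N / (1 - q))).
  - intros N. split; [apply Cmod_ge_0|].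
    assert (Hw' : RtoC w <> RtoC 0) by (intros E; injection E; lra).
    replace (A n / RtoC w - charlier_Csum lambda c N n)%C
      with ((A n - RtoC w * charlier_Csum lambda c N n) / RtoC w)%C by (field; auto).
    rewrite Cmod_div, Cmod_R, (Rabs_pos_eq w) by (auto; lra).
    apply Rmult_le_reg_r with (w * rho ^ n); [now apply Rmult_lt_0_compat|].
    replace (K * (M * q ^ S N / (1 - q)) * (w * rho ^ n))
      with (exp (lambda * rho) * (M * q ^ S N / (1 - q))).
    + replace (_ / w * (w * rho ^ n)) with
        (Cmod (A n - RtoC w * charlier_Csum lambda c N n) * rho ^ n) by (field; lra).
      apply Hd.
    + destruct Hg as (_ & Hq & _). unfold K. field. lra.
  - replace (Finite 0) with (Rbar_mult K 0) by (simpl; f_equal; ring).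
    apply is_lim_seq_scal_l, is_lim_seq_geom_tail, Hg.
Qed.

End Scaled.

End TaylorAtOne.

Theorem proposition2p2 :
  forall (lambda H : R) (f : C -> C) (A : nat -> C),
    0 < lambda -> 0 <= H -> 2 * H < lambda ->
    entire f ->
    big_O_at_infinity f (fun z => exp (H * Cmod (z - 1)%C ^ 2)) ->
    taylor_coeffs (fun z => (Cexp (RtoC lambda * (z - 1)) * f z)%C) 0%C A ->
    let term n :=
      Cmod (A n / RtoC (poisson_weight lambda n))%C ^ 2
        * poisson_weight lambda n in
    let integrand r := circle_mean f (sqrt (r / lambda)) * exp (- r) in
    ex_series term /\
    ex_RInt_gen integrand (at_point 0) (Rbar_locally p_infty) /\
    Series term = RInt_gen integrand (at_point 0) (Rbar_locally p_infty).
Proof.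
  intros lambda H f A Hl HH HlH Hf HO HA term integrand.
  destruct (Hf 1%C) as [c Hc0].
  pose proof (entire_taylor_psums f 1%C c Hf Hc0) as Hc.
  destruct (big_O_global f c Hc H HH HO) as (K & HK & Hb).
  set (p := scaled_coeff c lambda).
  assert (Hp : forall k, 0 <= p k) by (intros; now apply scaled_coeff_pos).
  assert (HCV : CV_radius p = p_infty) by now apply (scaled_coeff_radius f c Hc).
  (* The square of the global bound [K * exp (H * rho ^ 2)] at [rho ^ 2 = r / lambda]; squaring is
     what turns [H] into [2 * H]. *)
  assert (Hgrowth : forall r, 0 <= r -> PSeries p r <= K ^ 2 * exp (2 * H / lambda * r)).
  { intros r Hr. unfold p. rewrite <- (circle_mean_PSeries f c Hc lambda Hl r Hr).
    replace (K ^ 2 * exp (2 * H / lambda * r)) with ((K * exp (H * (r / lambda))) ^ 2).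
    - apply (circle_mean_le f c Hc); [apply sqrt_pos|].
      intros w Hw. eapply Rle_trans; [apply Hb|].
      rewrite Hw, pow2_sqrt by (apply Rdiv_le_0_compat; lra). lra.
    - rewrite Rpow_mult_distr. f_equal. simpl. rewrite Rmult_1_r, <- exp_plus.
      f_equal. field. lra. }
  assert (Halpha : 2 * H / lambda < 1).
  { apply Rmult_lt_reg_r with lambda; auto. field_simplify; lra. }
  set (s := sum_n (fun k => p k * INR (fact k))).
  assert (Hterm : forall k, 0 <= p k * INR (fact k))
    by (intros; apply Rmult_le_pos; auto; apply pos_INR).
  assert (Hincr : forall n, s n <= s (S n)).
  { intros n. unfold s. rewrite sum_Sn. change plus with Rplus. specialize (Hterm (S n)). lra. }
  (* [sigma] is produced before either side is known to converge; both are then shown to converge to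
     it. *)
  destruct (ex_finite_lim_seq_incr s (K ^ 2 / (1 - 2 * H / lambda))) as [sigma Hsigma]; auto.
  { intros n. now apply factorial_moments_bounded. }
  assert (Hs : is_series (fun k => p k * INR (fact k)) sigma) by exact Hsigma.
  assert (Hsum : is_series term sigma).
  { apply (is_series_ext (fun n => poisson_weight lambda n
      * Cmod (A n / RtoC (poisson_weight lambda n))%C ^ 2)).
    { intros n. apply Rmult_comm. }
    assert (Es : forall N, sum_n (fun k => Cmod (c k) ^ 2 * (INR (fact k) / lambda ^ k)) N = s N).
    { intros N. apply sum_n_ext. intros k. unfold p, scaled_coeff, Rdiv. eqR. ring. }
    apply (weighted_l2_limit (poisson_weight lambda) (charlier_Csum lambda c) _ s).
    - intros n. left. now apply poisson_weight_pos.
    - intros n. now apply (taylor_at_0_approx f c Hc).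
    - intros N. rewrite <- Es. now apply charlier_Csum_norm.
    - intros M N HMN. rewrite <- !Es. now apply charlier_Csum_diff_norm.
    - exact Hsigma.
    - intros N. now apply is_lim_seq_incr_compare. }
  assert (HI : is_RInt_gen integrand (at_point 0) (Rbar_locally p_infty) sigma).
  { apply (is_RInt_gen_PSeries_exp p); auto.
    intros r Hr. unfold integrand. rewrite (circle_mean_PSeries f c Hc) by lra. reflexivity. }
  split; [now exists sigma|]. split; [now exists sigma|].
  rewrite (is_series_unique _ _ Hsum). symmetry. now apply is_RInt_gen_unique.
Qed.
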